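(* Let $M=\{m_{ikj}\}_{i,k,j\ge1}$ be a three-dimensional matrix with complex entries and, for $k\ge1$, let $M(k)=\{m_{ikj}\}_{i,j\ge1}$. Then $M$ is a bilinear Schur multiplier into $\mathcal S^1$ if and only if $M(k)$ is a linear Schur multiplier on $\mathcal S^\infty$ for every $k\ge1$ and $\sup_{k\ge1}\|M(k):\mathcal S^\infty\to\mathcal S^\infty\|<\infty$. Moreover, in this case, $$ \bigl\Vert M:\mathcal S^2\times\mathcal S^2\to\mathcal S^1\bigr\Vert=\sup_{k\ge1}\bigl\Vert M(k):\mathcal S^\infty\to\mathcal S^\infty\bigr\Vert . $$
   Context: Elements of $B(\ell^2)$ are regarded as infinite matrices; $E_{ij}$ are the matrix units. $\mathcal S^p$ ($1\le p<\infty$) is the Schatten class in $B(\ell^2)$ with norm $\|\cdot\|_p$, and $\mathcal S^\infty$ is the space of compact operators on $\ell^2$ with the operator norm. A matrix $\{m_{ij}\}_{i,j\ge1}$ is a linear Schur multiplier on $\mathcal S^p$ if $A=\{a_{ij}\}\mapsto\sum_{i,j\ge1}m_{ij}a_{ij}E_{ij}$ defines a bounded linear operator on $\mathcal S^p$; its norm as such an operator is denoted $\|\{m_{ij}\}:\mathcal S^p\to\mathcal S^p\|$. A three-dimensional matrix $M=\{m_{ikj}\}_{i,k,j\ge1}$ is a bilinear Schur multiplier into $\mathcal S^r$ if $M(A,B)=\sum_{i,j,k\ge1}m_{ikj}a_{ik}b_{kj}E_{ij}$, for $A=\{a_{ij}\},B=\{b_{ij}\}\in\mathcal S^2$, defines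 a bounded bilinear operator from $\mathcal S^2\times\mathcal S^2$ into $\mathcal S^r$; its norm is denoted $\|M:\mathcal S^2\times\mathcal S^2\to\mathcal S^r\|$. *)

(* Defs.v *)
From HB Require Import structures.
From mathcomp Require Import all_boot all_order all_algebra.
From mathcomp Require Import complex ring.
From mathcomp Require Import all_classical all_reals all_analysis.
Set Implicit Arguments.
Unset Strict Implicit.
Unset Printing Implicit Defensive.
Import Order.TTheory GRing.Theory Num.Theory.
Import numFieldNormedType.Exports.
Local Open Scope classical_set_scope.
Local Open Scope ring_scope.

Local Notation normc := Normc.normc.

(* The library puts the norm topology on R[i]^o only. *)
#[non_forgetful_inheritance]
HB.instance Definition _ (R : realType) := NormedModule.copy R[i] R[i]^o.

Section SquareSummable.
Variable R : realType.
Implicit Types (x y : nat -> R[i]) (a : R[i]).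

Definition sqsum x : \bar R := (\sum_(0 <= n <oo) ((normc (x n)) ^+ 2)%:E)%E.

Definition sqsummable : {pred nat -> R[i]} := fun x => `[< (sqsum x < +oo)%E >].

Lemma sqsum_ge0 x : (0 <= sqsum x)%E.
Proof. by apply: nneseries_ge0 => n _ _; rewrite lee_fin sqr_ge0. Qed.

Lemma sqsum_fin x : x \in sqsummable -> sqsum x \is a fin_num.
Proof. by move=> /asboolP; rewrite ge0_fin_numE// sqsum_ge0. Qed.

Lemma normc_ge0 a : 0 <= normc a.
Proof. by case: a => u v /=; rewrite sqrtr_ge0. Qed.

Lemma normc_normE a : (normc a)%:C%C = `|a|.
Proof. by case: a. Qed.

Lemma sqsumZ a x : sqsum (a *: x) = ((normc a ^+ 2)%:E * sqsum x)%E.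
Proof.
rewrite /sqsum -nneseriesZl; last by move=> n _; rewrite lee_fin sqr_ge0.
by apply: eq_eseriesr => n _; rewrite -EFinM -exprMn -Normc.normcM.
Qed.

(* |u + v|^2 <= (1 + t) |u|^2 + (1 + 1/t) |v|^2, summed; the choice
   t = |y|/|x| gives the triangle inequality. *)
Lemma sqsumD x y (t : R) : 0 < t ->
  (sqsum (x + y)%R <= (1 + t)%:E * sqsum x + (1 + t^-1)%:E * sqsum y)%E.
Proof.
move=> t0; have ti0 : 0 < t^-1 by rewrite invr_gt0.
have sq0 (u : nat -> R[i]) n : (0 <= ((normc (u n)) ^+ 2)%:E)%E.
  by rewrite lee_fin sqr_ge0.
have t1 : 0 <= 1 + t by rewrite addr_ge0// ltW.
have t2 : 0 <= 1 + t^-1 by rewrite addr_ge0// ltW.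
rewrite /sqsum -!nneseriesZl//; do 2 ?by move=> n _; exact: sq0.
rewrite -nneseriesD; do 2 ?by move=> n _ _; rewrite mule_ge0// lee_fin.
apply: lee_nneseries => [n _ _|n _]; first exact: sq0.
rewrite -!EFinM -EFinD lee_fin.
have le_D : normc ((x + y) n) <= normc (x n) + normc (y n) by exact: le_normcD.
apply: (@le_trans _ _ ((normc (x n) + normc (y n)) ^+ 2)).
  by rewrite ler_sqr ?nnegrE ?addr_ge0 ?normc_ge0.
move: (normc (x n)) (normc (y n)) => p q.
rewrite -subr_ge0.
suff -> : (1 + t) * p ^+ 2 + (1 + t^-1) * q ^+ 2 - (p + q) ^+ 2 =
          t * (p - t^-1 * q) ^+ 2 by rewrite mulr_ge0 ?sqr_ge0 ?ltW.
by field; rewrite gt_eqF.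
Qed.

Lemma sqsummable_closed : GRing.submod_closed sqsummable.
Proof.
split.
  apply/asboolP; rewrite /sqsum eseries0// => n _ _.
  by rewrite Normc.normc0 expr0n.
move=> a x y xs ys; apply/asboolP.
apply: le_lt_trans (sqsumD _ _ ltr01) _.
rewrite sqsumZ ltey_eq fin_numD ?fin_numM ?sqsum_fin//.
Qed.

HB.instance Definition _ :=
  GRing.isSubmodClosed.Build R[i] (nat -> R[i]) sqsummable sqsummable_closed.

End SquareSummable.

Record ell2 (R : realType) :=
  Ell2 { ell2_val :> nat -> R[i]; _ : ell2_val \in @sqsummable R }.

HB.instance Definition _ (R : realType) := [isSub of ell2 R for @ell2_val R].
HB.instance Definition _ (R : realType) := [Choice of ell2 R by <:].
HB.instance Definition _ (R : realType) :=
  [SubChoice_isSubLmodule of ell2 R by <:].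

Section Ell2Norm.
Variable R : realType.
Implicit Types (x y : ell2 R).

Definition l2norm x : R := Num.sqrt (fine (sqsum x)).

Lemma l2norm_ge0 x : 0 <= l2norm x. Proof. exact: sqrtr_ge0. Qed.

Lemma l2norm_sq x : (l2norm x ^+ 2)%:E = sqsum x.
Proof.
rewrite /l2norm sqr_sqrtr ?fine_ge0 ?sqsum_ge0// fineK// sqsum_fin//.
exact: (valP x).
Qed.

Lemma l2norm_eq0 x : l2norm x = 0 -> x = 0.
Proof.
move=> x0; have := l2norm_sq x; rewrite x0 expr0n /= => sx0.
apply: val_inj; apply/funext => n /=.
have : ((normc (x n) ^+ 2)%:E <= 0)%E.
  rewrite [leRHS]sx0 /sqsum (@nneseriesD1 _ _ n)//; last first.
    by move=> k _; rewrite lee_fin sqr_ge0.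
  by rewrite leeDl// nneseries_ge0// => k _ _; rewrite lee_fin sqr_ge0.
rewrite lee_fin => n0; apply: Normc.eq0_normc; apply/eqP.
by rewrite -(@sqrf_eq0 R) eq_le n0 sqr_ge0.
Qed.

Lemma l2normZ (a : R[i]) x : l2norm (a *: x) = normc a * l2norm x.
Proof.
rewrite /l2norm /= sqsumZ fineM// ?sqsum_fin ?(valP x)//=.
by rewrite sqrtrM ?sqr_ge0// sqrtr_sqr ger0_norm// normc_ge0.
Qed.

Lemma l2normD x y : l2norm (x + y) <= l2norm x + l2norm y.
Proof.
have [/l2norm_eq0->|x0] := eqVneq (l2norm x) 0.
  by rewrite add0r lerDr l2norm_ge0.
have [/l2norm_eq0->|y0] := eqVneq (l2norm y) 0.
  by rewrite addr0 lerDl l2norm_ge0.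
have t0 : 0 < l2norm y / l2norm x.
  by rewrite divr_gt0// lt0r ?x0 ?y0 l2norm_ge0.
rewrite -ler_sqr ?nnegrE ?addr_ge0 ?l2norm_ge0// -lee_fin l2norm_sq.
apply: (le_trans (sqsumD x y t0)).
rewrite -!l2norm_sq -!EFinM -EFinD lee_fin le_eqVlt; apply/orP; left; apply/eqP.
by field; rewrite x0 y0.
Qed.

Let norm x : R[i] := (l2norm x)%:C%C.

Let ler_normD x y : norm (x + y) <= norm x + norm y.
Proof. by rewrite /norm -rmorphD lecR l2normD. Qed.

Let normrZ (a : R[i]) x : norm (a *: x) = `|a| * norm x.
Proof. by rewrite /norm l2normZ rmorphM /= normc_normE. Qed.

Let normr0_eq0 x : norm x = 0 -> x = 0.
Proof. by move=> /complexI/l2norm_eq0. Qed.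

HB.instance Definition _ :=
  Lmodule_isNormed.Build R[i] (ell2 R) ler_normD normrZ normr0_eq0.

End Ell2Norm.

Lemma ell2_normE (R : realType) (x : ell2 R) : `|x| = (l2norm x)%:C%C.
Proof. by []. Qed.

Section Operators.
Variable R : realType.

Definition delta (k : nat) : nat -> R[i] := fun n => (n == k)%:R.

Lemma delta_sqsummable k : delta k \in @sqsummable R.
Proof.
apply/asboolP; rewrite /sqsum (@nneseriesD1 _ _ k)//; last first.
  by move=> n _; rewrite lee_fin sqr_ge0.
rewrite eseries0 ?adde0 ?ltry// => n _ /= nk.
by rewrite /delta (negbTE nk) Normc.normc0 expr0n.
Qed.

Definition ebasis (k : nat) : ell2 R := Ell2 (delta_sqsummable k).

Definition dot (x y : ell2 R) : R[i] := limn (series (fun n => x n * (y n)^*)).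

Definition op := {linear ell2 R -> ell2 R}.
Implicit Types T S : op.

(* a_ij = <T e_j, e_i>, with indices starting at 0. *)
Definition mxentry T (i j : nat) : R[i] := T (ebasis j) i.

Definition unit_ball : set (ell2 R) := [set x | `|x| <= 1].

Definition opnorm T : \bar R := ereal_sup [set (l2norm (T x))%:E | x in unit_ball].

Definition compact_op : set op :=
  [set T : op | continuous T /\ precompact (T @` unit_ball)].

Definition is_adjoint T S := forall x y, dot (T x) y = dot x (S y).

Definition positive_op T := forall x, 0 <= dot (T x) x.

(* P = (T^* T)^(1/2), the unique positive bounded square root of T^* T. *)
Definition is_abs T : set op := [set P : op |
  [/\ continuous P, positive_op P &
      exists2 S : op, is_adjoint T S & forall x, P (P x) = S (T x)]].

(* |T|; the default value 0 is never used when T is bounded. *)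
Definition op_abs T : op := xget (\0 : op) (is_abs T).

(* tr (|T|^p); the diagonal entries are nonnegative. *)
Definition trace_abs_pow (p : nat) T : \bar R :=
  (\sum_(0 <= n <oo) (complex.Re (iter p (op_abs T) (ebasis n) n))%:E)%E.

(* The Schatten norm and class of integer exponent p >= 1. *)
Definition schatten_norm (p : nat) T : \bar R :=
  (trace_abs_pow p T `^ p%:R^-1)%E.

Definition schatten (p : nat) : set op :=
  [set T : op | continuous T /\ (schatten_norm p T < +oo)%E].

Definition schur_product (m : nat -> nat -> R[i]) A T :=
  forall i j, mxentry T i j = m i j * mxentry A i j.

(* An operator is determined by its matrix, so T depends linearly on A.
   The class X carries the norm nX. *)
Definition linear_schur_multiplier (X : set op) (nX : op -> \bar R)
    (m : nat -> nat -> R[i]) :=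
  exists c : R, forall A, X A ->
    exists T, [/\ X T, schur_product m A T & (nX T <= c%:E * nX A)%E].

Definition linear_schur_norm (X : set op) (nX : op -> \bar R)
    (m : nat -> nat -> R[i]) : \bar R :=
  ereal_sup [set nX T | T in [set T : op | X T /\
    exists A, [/\ X A, (nX A <= 1)%E & schur_product m A T]]].

(* M(A, B) = T: the (i, j) entry of T is the sum of the series
   \sum_k m_ikj a_ik b_kj. *)
Definition schur_product2 (M : nat -> nat -> nat -> R[i]) A B T :=
  forall i j, series (fun k => M i k j * mxentry A i k * mxentry B k j) @ \oo
                --> mxentry T i j.

(* A multiplier from S^2 x S^2 into S^r. *)
Definition bilinear_schur_multiplier (r : nat)
    (M : nat -> nat -> nat -> R[i]) :=
  exists c : R, forall A B, schatten 2 A -> schatten 2 B ->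
    exists T, [/\ schatten r T, schur_product2 M A B T &
      (schatten_norm r T <= c%:E * schatten_norm 2 A * schatten_norm 2 B)%E].

Definition bilinear_schur_norm (r : nat)
    (M : nat -> nat -> nat -> R[i]) : \bar R :=
  ereal_sup [set schatten_norm r T | T in [set T : op | schatten r T /\
    exists A B, [/\ schatten 2 A, schatten 2 B, (schatten_norm 2 A <= 1)%E,
                    (schatten_norm 2 B <= 1)%E & schur_product2 M A B T]]].

End Operators.

(* Main.v *)
Require Import Defs.
From HB Require Import structures.
From mathcomp Require Import all_boot all_order all_algebra.
From mathcomp Require Import complex ring lra sesquilinear spectral.
From mathcomp Require Import all_classical all_reals all_analysis.

(** Let s be a common bound for the norms of the multipliers M(k). For A, B in
    S^2 the product M(A, B) is the sum over k of the matrices whose entries are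
    m_ikj a_ik b_kj, that is, of M(k) acting on the rank one matrix built from
    the k-th column of A and the k-th row of B. By trace duality the
    trace norm of the sum is the supremum of its pairings with finite matrices X
    of operator norm at most 1, and the k-th term of such a pairing is the
    bilinear form of the Schur product M(k) X evaluated at that column and that
    row. It is at most s times the product of their norms, and Cauchy-Schwarz
    in k gives s |A|_2 |B|_2 ([partial_pairing_bound]).

    Conversely, if A has the single nonzero column u (the k-th one) and B the
    single nonzero row w (the k-th one), then M(A, B) has entries m_ikj u_i w_j,
    and its pairing with X is the bilinear form of M(k) X at u and w. Hence M(k)
    maps finite contractions to matrices of norm at most the norm of M
    ([schur_section_of_bilinear]); it then acts on all compact operators
    with the same bound, and the product stays compact because removing the
    first rows of a matrix commutes with Schur multiplication
    ([linear_of_schur_section]).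

    All the estimates are made on finite sections: [section_bound] bounds the
    bilinear form of an I x N corner of a matrix, and [matrix_op]
    reconstructs an operator from uniformly bounded sections. Trace duality
    enters in two one-sided forms. The upper bound for the trace norm
    ([trace_abs_le]) comes from diagonalizing the Gram matrix of
    T e_0, .., T e_(N-1); the lower bound ([trace_abs_ge]), for T with finitely
    many nonzero columns, from diagonalizing |T| on the span of the
    corresponding basis vectors. Both use only that |T| is positive and that
    |T| x and T x have the same norm.

    That a bounded operator has an absolute value at all ([op_abs_exists]) is
    needed to identify the Schatten 2-norm with the Hilbert-Schmidt norm; the
    square root is the limit of the iteration X -> (D + X^2) / 2
    ([sqrt_fixpoint]). *)

Set Implicit Arguments.
Unset Strict Implicit.
Unset Printing Implicit Defensive.
Import Order.TTheory GRing.Theory Num.Theory.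
Import numFieldNormedType.Exports.
Local Open Scope classical_set_scope.
Local Open Scope ring_scope.
Local Notation normc := Normc.normc.

(** * Complex sequences *)

Section ComplexSequences.
Variable R : realType.
Implicit Types (z w : R[i]) (u v : nat -> R[i]).

Lemma normc_conj z : normc z^* = normc z.
Proof. by apply: complexI; rewrite !normc_normE norm_conjC. Qed.

Lemma normcB z w : normc (z - w) = normc (w - z).
Proof. by rewrite -normcN opprB. Qed.

Lemma normc_real (a : R) : 0 <= a -> normc a%:C%C = a.
Proof. by move=> a0; apply: complexI; rewrite normc_normE ger0_norm// ler0c. Qed.

Lemma mul_conj_normc z : z * z^* = (normc z ^+ 2)%:C%C.
Proof. by rewrite -normCK -normc_normE rmorphXn. Qed.

Lemma Re_le_normc z : complex.Re z <= normc z.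
Proof.
case: z => a b /=; apply: le_trans (ler_norm a) _.
by rewrite -sqrtr_sqr ler_wsqrtr// lerDl sqr_ge0.
Qed.

Lemma normc_le_Re_Im z : normc z <= `|complex.Re z| + `|complex.Im z|.
Proof.
have -> : z = (complex.Re z)%:C%C + 'i%C * (complex.Im z)%:C%C by exact: complexE.
apply: le_trans (le_normcD _ _) _.
rewrite Normc.normcM /= !expr0n /= !addr0 !add0r !sqrtr_sqr normr1 mul1r.
by simpc.
Qed.

Lemma normc_sum n (F : 'I_n -> R[i]) :
  normc (\sum_(i < n) F i) <= \sum_(i < n) normc (F i).
Proof.
elim/big_ind2 : _ => [|x a y b xa yb|//]; first by rewrite Normc.normc0.
by apply: le_trans (le_normcD _ _) _; exact: lerD.
Qed.

(** Radii of balls in R[i] are complex; a positive one is real. *)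
Lemma cvg_normcP u (l : R[i]) :
  u @ \oo --> l <-> forall e : R, 0 < e -> \forall n \near \oo, normc (l - u n) < e.
Proof.
split=> [/cvgrPdist_lt ul e e0|ul].
  have : 0 < e%:C%C :> R[i] by rewrite ltcR.
  move=> /ul; apply: filterS => n /=.
  by rewrite -normc_normE ltcR.
apply/cvgrPdist_lt => e e0.
have eE : e = (complex.Re e)%:C%C by rewrite RRe_real// gtr0_real.
have : 0 < complex.Re e by rewrite -ltcR -eE.
move=> /ul; apply: filterS => n /=.
by rewrite -normc_normE eE ltcR.
Qed.

Lemma cvg_normc u (l : R[i]) : u @ \oo --> l -> (fun n => normc (u n)) @ \oo --> normc l.
Proof.
move=> /cvg_normcP ul; apply/cvgrPdist_lt => e /ul; apply: filterS => n /=.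
apply: le_lt_trans; rewrite ler_norml; apply/andP; split.
  rewrite lerBrDl -[X in X <= _]addr0 -subr_ge0.
  have := le_normcD (u n - l) l; rewrite subrK normcB; lra.
have := le_normcD (l - u n) (u n); rewrite subrK; lra.
Qed.

Lemma cvgC u (l : R[i]) : u @ \oo --> l -> (fun n => (u n)^*) @ \oo --> l^*.
Proof.
move=> /cvg_normcP ul; apply/cvg_normcP => e /ul; apply: filterS => n.
by rewrite -rmorphB normc_conj.
Qed.

Lemma cvg_normc_le u (l : R[i]) (b : R) :
  u @ \oo --> l -> (\forall n \near \oo, normc (u n) <= b) -> normc l <= b.
Proof. by move=> /cvg_normc ul ub; apply: (cvgr_to_le ul). Qed.

Lemma cvg_uniq u (l l' : R[i]) : u @ \oo --> l -> u @ \oo --> l' -> l = l'.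
Proof. exact: (cvg_unique (@norm_hausdorff R[i] R[i]^o)). Qed.

Lemma cvg_Re_Im u :
  cvgn (fun n => complex.Re (u n)) -> cvgn (fun n => complex.Im (u n)) -> cvgn u.
Proof.
move=> cre cim.
apply: (cvgP (Complex (limn (fun n => complex.Re (u n)))
                      (limn (fun n => complex.Im (u n))))).
apply/cvg_normcP => e e0.
have e2 : 0 < e / 2 by rewrite divr_gt0.
move/cvgrPdist_lt : cre => /(_ _ e2) cre; move/cvgrPdist_lt : cim => /(_ _ e2) cim.
near=> n; apply: le_lt_trans (normc_le_Re_Im _) _.
rewrite [e]splitr; apply: ltrD.
  rewrite raddfB /=; near: n; exact: cre.
rewrite raddfB /=; near: n; exact: cim.
Unshelve. all: by end_near. Qed.

Lemma abs_Re_le z : `|complex.Re z| <= normc z.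
Proof. by case: z => x y /=; rewrite -sqrtr_sqr ler_wsqrtr// lerDl sqr_ge0. Qed.

Lemma abs_Im_le z : `|complex.Im z| <= normc z.
Proof. by case: z => x y /=; rewrite -sqrtr_sqr ler_wsqrtr// lerDr sqr_ge0. Qed.

(** The real and imaginary parts are Cauchy sequences of real numbers. *)
Lemma cauchy_cvgC u (e : nat -> R) : e @ \oo --> 0 ->
  (forall m n, (n <= m)%N -> normc (u m - u n) <= e n) -> cvgn u.
Proof.
move=> e0 ue.
have part (f : {additive R[i] -> R}) : (forall z, `|f z| <= normc z) ->
    cvgn (fun n => f (u n)).
  move=> fle; apply/cauchy_cvgP/cauchy_exP => _/posnumP[r].
  have [N _ /(_ N (leqnn N)) eN] : \forall n \near \oo, `|0 - e n| < r%:num.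
    by move/cvgrPdist_lt : e0; exact.
  exists (f (u N)); exists N => // m /= Nm; rewrite /ball /= distrC -raddfB.
  apply: le_lt_trans (fle _) _; apply: le_lt_trans (ue _ _ Nm) _.
  by apply: le_lt_trans eN; rewrite sub0r normrN ler_norm.
apply: cvg_Re_Im.
  exact: (part (@complex.Re R : {additive R[i] -> R}) abs_Re_le).
exact: (part (@complex.Im R : {additive R[i] -> R}) abs_Im_le).
Qed.

(** The real and imaginary parts are absolutely convergent real series. *)
Lemma abs_summable_cvg u (b : R) :
  (forall n, \sum_(i < n) normc (u i) <= b) -> cvgn (series u).
Proof.
move=> ub.
have part (f : R[i] -> R) : (forall z, `|f z| <= normc z) -> cvgn (series (f \o u)).
  move=> fle; apply: normed_cvg; apply: nondecreasing_is_cvgn.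
    apply/nondecreasing_seqP => n.
    by rewrite /normed_series_of !seriesEord /= big_ord_recr /= lerDl.
  exists b => _ [n _ <-]; rewrite /normed_series_of seriesEord /=.
  by apply: le_trans (ub n); apply: ler_sum => i _; exact: fle.
have cre : cvgn (series (@complex.Re R \o u)).
  exact: part abs_Re_le.
have cim : cvgn (series (@complex.Im R \o u)).
  exact: part abs_Im_le.
by apply: cvg_Re_Im; under eq_fun do rewrite raddf_sum /=.
Qed.

Lemma cvg_sum_ord (K : numFieldType) (V : pseudoMetricNormedZmodType K) n
    (F : 'I_n -> nat -> V) (l : 'I_n -> V) : (forall i, F i @ \oo --> l i) ->
  (fun m => \sum_(i < n) F i m) @ \oo --> \sum_(i < n) l i.
Proof.
move=> Fl; elim: n F l Fl => [|n IHn] F l Fl.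
  by under eq_fun do rewrite big_ord0; rewrite big_ord0; exact: cvg_cst.
under eq_fun do rewrite big_ord_recr; rewrite big_ord_recr.
by apply: cvgD; [exact: IHn|exact: Fl].
Qed.

End ComplexSequences.

(** * Geometry of the Hilbert space *)

Section Ell2Geometry.
Variable R : realType.
Implicit Types (f g : nat -> R[i]) (x y z : ell2 R) (N : nat).

(** With S, T the two sums of squares and c the sum of products, expanding
    the sum of the squares (T p_i - c q_i)^2 gives T (S T - c^2) >= 0. *)
Lemma sum_CS (I : finType) (p q : I -> R) :
  \sum_i p i * q i <=
  Num.sqrt (\sum_i p i ^+ 2) * Num.sqrt (\sum_i q i ^+ 2).
Proof.
set S := \sum_i p i ^+ 2; set T := \sum_i q i ^+ 2; set c := \sum_i _.
have S0 : 0 <= S by apply: sumr_ge0 => i _; exact: sqr_ge0.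
have T0 : 0 <= T by apply: sumr_ge0 => i _; exact: sqr_ge0.
rewrite -sqrtrM//; apply: le_trans (ler_norm _) _.
rewrite -sqrtr_sqr ler_wsqrtr//.
have [T00|TN0] := eqVneq T 0.
  have q0 i : q i = 0.
    apply/eqP; rewrite -sqrf_eq0; move/eqP: T00.
    by rewrite psumr_eq0 => [/allP /(_ i)|j _]; rewrite ?mem_index_enum ?sqr_ge0//; apply.
  by rewrite /c big1 ?expr0n ?mulr_ge0// => i _; rewrite q0 mulr0.
have Tp : 0 < T by rewrite lt0r TN0.
have : 0 <= \sum_i (T * p i - c * q i) ^+ 2 by apply: sumr_ge0 => i _; exact: sqr_ge0.
have -> : \sum_i (T * p i - c * q i) ^+ 2 = T * (S * T - c ^+ 2).
  rewrite (eq_bigr (fun i => T ^+ 2 * p i ^+ 2 + (- (2 * T * c)) * (p i * q i) +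
    c ^+ 2 * q i ^+ 2)) => [|i _]; last by ring.
  by rewrite !big_split /= -!mulr_sumr -/S -/T -/c; ring.
by rewrite pmulr_rge0// subr_ge0.
Qed.

Definition fnorm N f : R := Num.sqrt (\sum_(i < N) normc (f i) ^+ 2).

Lemma fnorm_ge0 N f : 0 <= fnorm N f. Proof. exact: sqrtr_ge0. Qed.
Hint Resolve fnorm_ge0 : core.

Lemma fnorm_sq N f : fnorm N f ^+ 2 = \sum_(i < N) normc (f i) ^+ 2.
Proof. by rewrite sqr_sqrtr//; apply: sumr_ge0 => i _; exact: sqr_ge0. Qed.

Lemma le_fnorm N f g : (forall i, (i < N)%N -> normc (f i) <= normc (g i)) ->
  fnorm N f <= fnorm N g.
Proof.
move=> fg; rewrite ler_wsqrtr//; apply: ler_sum => i _.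
by rewrite ler_sqr ?nnegrE ?normc_ge0// fg.
Qed.

Lemma eq_fnorm N f g : (forall i, (i < N)%N -> normc (f i) = normc (g i)) ->
  fnorm N f = fnorm N g.
Proof. by move=> fg; apply/eqP; rewrite eq_le !le_fnorm// => i /fg ->. Qed.

Lemma fnormZ N (a : R[i]) f : fnorm N (fun i => a * f i) = normc a * fnorm N f.
Proof.
rewrite /fnorm -[X in X * _](ger0_norm (normc_ge0 a)) -sqrtr_sqr -sqrtrM ?sqr_ge0//.
by rewrite mulr_sumr; congr Num.sqrt; apply: eq_bigr => i _; rewrite Normc.normcM exprMn.
Qed.

Lemma fnorm_conj N f : fnorm N (fun i => (f i)^*) = fnorm N f.
Proof. by apply: eq_fnorm => i _; rewrite normc_conj. Qed.

Lemma fnorm_CS_abs N f g :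
  \sum_(i < N) normc (f i) * normc (g i) <= fnorm N f * fnorm N g.
Proof. exact: sum_CS. Qed.

Lemma fnorm_CS N f g : normc (\sum_(i < N) f i * g i) <= fnorm N f * fnorm N g.
Proof.
apply: le_trans (fnorm_CS_abs N f g); apply: le_trans (normc_sum _) _.
by apply: ler_sum => i _; rewrite Normc.normcM.
Qed.

Lemma fnorm_mono f : {homo fnorm^~ f : m n / (m <= n)%N >-> m <= n}.
Proof.
move=> m n mn; rewrite ler_wsqrtr// -(subnKC mn) big_split_ord /= lerDl.
by apply: sumr_ge0 => i _; exact: sqr_ge0.
Qed.

Lemma cvg_fnorm N (u : nat -> nat -> R[i]) f :
  (forall i, (i < N)%N -> u^~ i @ \oo --> f i) ->
  (fun m => fnorm N (u m)) @ \oo --> fnorm N f.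
Proof.
move=> uf; apply: (@cvg_comp _ _ _ _ Num.sqrt); last exact: sqrt_continuous.
apply: cvg_sum_ord => i.
by apply: cvgM; apply: cvg_normc; exact: uf.
Qed.

Lemma fnorm_le_sqsum N f : ((fnorm N f ^+ 2)%:E <= sqsum f)%E.
Proof.
rewrite fnorm_sq -sumEFin /sqsum.
have := @nneseries_lim_ge R (fun n => (normc (f n) ^+ 2)%:E) xpredT 0%N N.
by rewrite big_mkord; apply => n _ _; rewrite lee_fin sqr_ge0.
Qed.

Lemma sqsum_le f (b : R) : (forall N, fnorm N f <= b) -> (sqsum f <= (b ^+ 2)%:E)%E.
Proof.
move=> fb; apply: lime_le.
  by apply: is_cvg_nneseries => n _ _; rewrite lee_fin sqr_ge0.
apply: nearW => N; rewrite big_mkord sumEFin lee_fin -fnorm_sq.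
by rewrite ler_sqr ?nnegrE// (le_trans _ (fb 0%N)).
Qed.

Lemma bounded_sqsummable f (b : R) : (forall N, fnorm N f <= b) ->
  f \in @sqsummable R.
Proof. by move=> /sqsum_le fb; apply/asboolP; exact: le_lt_trans fb (ltry _). Qed.

Lemma fnorm_le_l2norm N x : fnorm N x <= l2norm x.
Proof.
rewrite -ler_sqr ?nnegrE ?l2norm_ge0// -lee_fin l2norm_sq.
exact: fnorm_le_sqsum.
Qed.

Lemma l2norm_le x (b : R) : (forall N, fnorm N x <= b) -> l2norm x <= b.
Proof.
move=> xb; have b0 : 0 <= b by exact: le_trans (xb 0%N).
by rewrite -ler_sqr ?nnegrE ?l2norm_ge0// -lee_fin l2norm_sq; exact: sqsum_le.
Qed.

Lemma normc_le_l2norm x i : normc (x i) <= l2norm x.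
Proof.
apply: le_trans (fnorm_le_l2norm i.+1 x).
rewrite -ler_sqr ?nnegrE ?normc_ge0// fnorm_sq big_ord_recr /= lerDr.
by apply: sumr_ge0 => j _; exact: sqr_ge0.
Qed.

Lemma ell2P x y : x =1 y -> x = y.
Proof. by move=> xy; apply: val_inj; apply/funext. Qed.

Lemma ell2BE x y i : (x - y) i = x i - y i. Proof. by []. Qed.
Lemma ell2DE x y i : (x + y) i = x i + y i. Proof. by []. Qed.
Lemma ell2NE x i : (- x) i = - x i. Proof. by []. Qed.
Lemma ell2ZE (a : R[i]) x i : (a *: x) i = a * x i. Proof. by []. Qed.

Lemma l2normN x : l2norm (- x) = l2norm x.
Proof. by rewrite -scaleN1r l2normZ normcN Normc.normc1 mul1r. Qed.

Lemma l2norm0 : l2norm (0 : ell2 R) = 0.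
Proof. by rewrite -(scale0r 0) l2normZ Normc.normc0 mul0r. Qed.

Lemma l2normB x y : l2norm (x - y) = l2norm (y - x).
Proof. by rewrite -l2normN opprB. Qed.

(** Cauchy-Schwarz on initial segments gives absolute convergence, so the
    limit in the definition of [dot] is never a default value. *)
Lemma dot_cvg x y : series (fun n => x n * (y n)^*) @ \oo --> dot x y.
Proof.
apply: (@abs_summable_cvg _ _ (l2norm x * l2norm y)) => N.
apply: (@le_trans _ _ (fnorm N x * fnorm N y)).
  apply: le_trans (fnorm_CS_abs _ _ _); apply: ler_sum => i _.
  by rewrite Normc.normcM normc_conj.
by apply: ler_pM => //; exact: fnorm_le_l2norm.
Qed.

Lemma dotP x y (l : R[i]) :
  (fun N => \sum_(n < N) x n * (y n)^*) @ \oo --> l -> dot x y = l.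
Proof. by move=> xl; apply: cvg_uniq (@dot_cvg x y) _; rewrite seriesEord. Qed.

Lemma dot_cvg_sum x y : (fun N => \sum_(n < N) x n * (y n)^*) @ \oo --> dot x y.
Proof. by have := @dot_cvg x y; rewrite seriesEord. Qed.

Lemma dotDl x y z : dot (x + y) z = dot x z + dot y z.
Proof.
apply: dotP; under eq_fun do under eq_bigr do rewrite mulrDl.
under eq_fun do rewrite big_split /=.
by apply: cvgD; exact: dot_cvg_sum.
Qed.

Lemma dotZl (a : R[i]) x y : dot (a *: x) y = a * dot x y.
Proof.
apply: dotP; under eq_fun do under eq_bigr do rewrite -mulrA.
under eq_fun do rewrite -mulr_sumr.
by apply: cvgM; [exact: cvg_cst|exact: dot_cvg_sum].
Qed.

Lemma dotC x y : dot y x = (dot x y)^*.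
Proof.
apply: dotP; under eq_fun do under eq_bigr do rewrite mulrC -[X in _ * X]conjCK -rmorphM.
under eq_fun do rewrite -rmorph_sum.
by apply: cvgC; exact: dot_cvg_sum.
Qed.

Lemma dotDr x y z : dot z (x + y) = dot z x + dot z y.
Proof. by rewrite dotC dotDl rmorphD /= -!dotC. Qed.

Lemma dotZr (a : R[i]) x y : dot x (a *: y) = a^* * dot x y.
Proof. by rewrite dotC dotZl rmorphM /= -dotC. Qed.

Lemma dot0l x : dot 0 x = 0. Proof. by rewrite -(scale0r 0) dotZl mul0r. Qed.
Lemma dot0r x : dot x 0 = 0. Proof. by rewrite dotC dot0l rmorph0. Qed.
Lemma dotNl x y : dot (- x) y = - dot x y.
Proof. by rewrite -scaleN1r dotZl mulN1r. Qed.
Lemma dotNr x y : dot x (- y) = - dot x y.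
Proof. by rewrite dotC dotNl rmorphN /= -dotC. Qed.
Lemma dotBl x y z : dot (x - y) z = dot x z - dot y z.
Proof. by rewrite dotDl dotNl. Qed.
Lemma dotBr x y z : dot z (x - y) = dot z x - dot z y.
Proof. by rewrite dotDr dotNr. Qed.

Lemma dot_suml n (F : 'I_n -> ell2 R) y :
  dot (\sum_(i < n) F i) y = \sum_(i < n) dot (F i) y.
Proof. by elim/big_rec2 : _ => [|i a b _ <-]; rewrite ?dot0l ?dotDl. Qed.

Lemma dot_sumr n (F : 'I_n -> ell2 R) y :
  dot y (\sum_(i < n) F i) = \sum_(i < n) dot y (F i).
Proof. by elim/big_rec2 : _ => [|i a b _ <-]; rewrite ?dot0r ?dotDr. Qed.

Lemma dot_CS x y : normc (dot x y) <= l2norm x * l2norm y.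
Proof.
apply: (cvg_normc_le (@dot_cvg_sum x y)); apply: nearW => N.
apply: le_trans (fnorm_CS N x (fun n => (y n)^*)) _.
by rewrite fnorm_conj; apply: ler_pM => //; exact: fnorm_le_l2norm.
Qed.

Lemma fnorm_cvg x : (fun N => fnorm N x) @ \oo --> l2norm x.
Proof.
have cv : cvgn (fun N => fnorm N x).
  apply: nondecreasing_is_cvgn; first exact: fnorm_mono.
  by exists (l2norm x) => _ [N _ <-]; exact: fnorm_le_l2norm.
suff -> : l2norm x = limn (fun N => fnorm N x) by exact: cv.
apply/eqP; rewrite eq_le; apply/andP; split.
  apply: l2norm_le => N; apply: nondecreasing_cvgn_le => //; exact: fnorm_mono.
by apply: limr_le => //; apply: nearW => N; exact: fnorm_le_l2norm.
Qed.

Lemma dot_self x : dot x x = (l2norm x ^+ 2)%:C%C.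
Proof.
apply: dotP; apply/cvg_normcP => e e0.
have : (fun N => fnorm N x ^+ 2) @ \oo --> l2norm x ^+ 2.
  by rewrite !expr2; under eq_fun do rewrite expr2; apply: cvgM; exact: fnorm_cvg.
move/cvgrPdist_lt => /(_ e e0); apply: filterS => N /=; apply: le_lt_trans.
under eq_bigr do rewrite mul_conj_normc.
rewrite -rmorph_sum -fnorm_sq -rmorphB /= expr0n addr0 sqrtr_sqr; exact: lexx.
Qed.

Lemma ebasisE k n : ebasis R k n = (n == k)%:R. Proof. by []. Qed.

Lemma dot_ebasis x k : dot x (ebasis R k) = x k.
Proof.
apply: dotP; apply: cvg_near_cst; exists k.+1 => // N /= kN.
rewrite (bigD1 (Ordinal kN)) //= /delta eqxx rmorph1 mulr1 big1 ?addr0// => i ik.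
by rewrite -val_eqE /= in ik; rewrite (negPf ik) rmorph0 mulr0.
Qed.

Definition ftrunc N f : ell2 R := \sum_(n < N) f n *: ebasis R n.

Lemma ftruncE N f i : ftrunc N f i = if (i < N)%N then f i else 0.
Proof.
rewrite -dot_ebasis dot_suml.
under eq_bigr do rewrite dotZl dot_ebasis ebasisE.
case: ltnP => iN.
  rewrite (bigD1 (Ordinal iN)) //= eqxx mulr1 big1 ?addr0// => j ji.
  by rewrite -val_eqE /= eq_sym in ji; rewrite (negPf ji) mulr0.
rewrite big1// => j _; rewrite gtn_eqF ?mulr0//.
by apply: leq_trans (ltn_ord j) iN.
Qed.

Lemma l2norm_ftrunc N f : l2norm (ftrunc N f) = fnorm N f.
Proof.
apply/eqP; rewrite eq_le; apply/andP; split; last first.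
  apply: le_trans (fnorm_le_l2norm N _); apply: le_fnorm => i iN.
  by rewrite ftruncE iN.
apply: l2norm_le => M; have [MN|NM] := leqP M N.
  apply: le_trans (fnorm_mono _ MN); apply: le_fnorm => i iN.
  by rewrite ftruncE (leq_trans iN MN).
rewrite ler_wsqrtr// -(subnKC (ltnW NM)) big_split_ord /= [X in _ + X]big1 ?addr0.
  by apply: ler_sum => i _; rewrite ftruncE ltn_ord.
by move=> i _; rewrite ftruncE ifN -?leqNgt ?leq_addr// Normc.normc0 expr0n.
Qed.

(** Pythagoras on every initial segment. This gives both the convergence of the
    truncations and the contractivity of tails. *)
Lemma l2norm_tail x N : l2norm (x - ftrunc N x) ^+ 2 <= l2norm x ^+ 2 - fnorm N x ^+ 2.
Proof.
have D0 : 0 <= l2norm x ^+ 2 - fnorm N x ^+ 2.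
  by rewrite subr_ge0 ler_sqr ?nnegrE ?l2norm_ge0// fnorm_le_l2norm.
rewrite -[leRHS](sqr_sqrtr D0) ler_sqr ?nnegrE ?l2norm_ge0 ?sqrtr_ge0//.
apply: l2norm_le => M; apply: le_trans (fnorm_mono _ (leq_maxr N M)) _.
rewrite -ler_sqr ?nnegrE ?sqrtr_ge0// [leRHS]sqr_sqrtr// lerBrDl.
apply: le_trans (_ : fnorm (maxn N M) x ^+ 2 <= _); last first.
  by rewrite ler_sqr ?nnegrE ?l2norm_ge0// fnorm_le_l2norm.
rewrite !fnorm_sq -(subnKC (leq_maxl N M)) !big_split_ord /=.
rewrite [X in _ + (X + _)]big1 ?add0r; last first.
  move=> i _; rewrite -[X in normc X]/(x i - ftrunc N x i) ftruncE ltn_ord.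
  by rewrite subrr Normc.normc0 expr0n.
rewrite lerD2l; apply: ler_sum => i _.
rewrite -[X in normc X ^+ 2 <= _]/(x (N + i)%N - ftrunc N x (N + i)%N).
by rewrite ftruncE ltnNge leq_addr /= subr0.
Qed.

Lemma ftrunc_cvg x (e : R) : 0 < e ->
  exists N, forall n, (N <= n)%N -> l2norm (x - ftrunc n x) < e.
Proof.
move=> e0.
have : (fun N => fnorm N x ^+ 2) @ \oo --> l2norm x ^+ 2.
  by rewrite !expr2; under eq_fun do rewrite expr2; apply: cvgM; exact: fnorm_cvg.
move/cvgrPdist_lt => /(_ (e ^+ 2) (exprn_gt0 _ e0)) [N _ Ne]; exists N => n Nn.
rewrite -ltr_sqr ?nnegrE ?l2norm_ge0 ?ltW//.
apply: le_lt_trans (l2norm_tail _ _) _; apply: le_lt_trans (Ne n Nn).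
exact: ler_norm.
Qed.

(** Completeness, with a rate: the coordinates converge and the bound passes
    to the limit on finite sections. *)
Lemma ell2_complete (u : nat -> ell2 R) (e : nat -> R) : e @ \oo --> 0 ->
  (forall m n, (n <= m)%N -> l2norm (u m - u n) <= e n) ->
  exists y, forall n, l2norm (y - u n) <= e n.
Proof.
move=> e0 ue.
have cu i : cvgn (fun m => u m i).
  apply: cauchy_cvgC e0 _ => m n nm; apply: le_trans (ue _ _ nm).
  exact: (normc_le_l2norm (u m - u n)).
pose l i := limn (fun m => u m i).
have le_e N n : fnorm N (fun i => l i - u n i) <= e n.
  have /cvgr_to_le : (fun m => fnorm N (fun i => u m i - u n i)) @ \oo -->
      fnorm N (fun i => l i - u n i).
    apply: (@cvg_fnorm N (fun m i => u m i - u n i)) => i _.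
    by apply: cvgB; [exact: cu|exact: cvg_cst].
  apply; exists n => // m /= nm; apply: le_trans (ue _ _ nm).
  exact: (fnorm_le_l2norm _ (u m - u n)).
have d0 : (fun i => l i - u 0%N i) \in @sqsummable R.
  by apply: (@bounded_sqsummable _ (e 0%N)) => N; exact: le_e.
exists (Ell2 d0 + u 0%N) => n; apply: l2norm_le => N; apply: le_trans (le_e N n).
by apply: le_fnorm => i _ /=; rewrite subrK.
Qed.

End Ell2Geometry.

Ltac ell2_ring := apply: ell2P => ?; rewrite !(ell2DE, ell2NE, ell2ZE); ring.

#[export] Hint Extern 0 (is_true (0 <= fnorm _ _)) => exact: fnorm_ge0 : core.

(** * Bounded operators and finite sections of matrices *)

Section BoundedOperators.
Variable R : realType.
Implicit Types (f g : nat -> R[i]) (x y z : ell2 R) (T S : op R) (C : R).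

Lemma nbhs_ell2P x (A : set (ell2 R)) :
  nbhs x A <-> exists2 e : R, 0 < e & forall y, l2norm (x - y) < e -> A y.
Proof.
split=> [/nbhs_normP[e /= e0 eA]|[e e0 eA]].
  have eE : e = (complex.Re e)%:C%C by rewrite RRe_real// gtr0_real.
  exists (complex.Re e) => [|y xy]; first by rewrite -ltcR -eE.
  by apply: eA; rewrite /= ell2_normE eE ltcR.
apply: (nbhs_normP x A).2; exists e%:C%C => [|y]; first by rewrite /= ltcR.
by rewrite /= ell2_normE ltcR; exact: eA.
Qed.

Lemma continuous_bounded T : continuous T ->
  exists2 C, 0 <= C & forall x, l2norm (T x) <= C * l2norm x.
Proof.
move=> /linear_bounded_continuous/linear_boundedP/pinfty_ex_gt0[r r0 rT].
have rE : r = (complex.Re r)%:C%C by rewrite RRe_real// gtr0_real.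
exists (complex.Re r) => [|x]; first by rewrite -lecR -rE ltW.
by have := rT x; rewrite !ell2_normE rE -rmorphM lecR.
Qed.

Lemma bounded_continuous T C : (forall x, l2norm (T x) <= C * l2norm x) ->
  continuous T.
Proof.
move=> TC; apply/linear_bounded_continuous/linear_boundedP.
exists C%:C%C; split; first by apply/complex_realP; exists C.
move=> r Cr x; rewrite !ell2_normE.
apply: (@le_trans _ _ (C * l2norm x)%:C%C); first by rewrite lecR.
by rewrite rmorphM ler_wpM2r ?ler0c ?l2norm_ge0 ?ltW.
Qed.

Lemma ftrunc_dist T C : 0 <= C -> (forall x, l2norm (T x) <= C * l2norm x) ->
  forall x (e : R), 0 < e ->
  exists N, forall n, (N <= n)%N -> l2norm (T x - T (ftrunc n x)) < e.
Proof.
move=> C0 TC x e e0.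
have C1 : 0 < C + 1 by rewrite ltr_wpDl.
have [N HN] := ftrunc_cvg x (divr_gt0 e0 C1); exists N => n /HN xn.
rewrite -linearB; apply: le_lt_trans (TC _) _.
apply: (@le_lt_trans _ _ ((C + 1) * l2norm (x - ftrunc n x))).
  by rewrite ler_wpM2r ?l2norm_ge0// lerDl.
by rewrite -ltr_pdivlMl// mulrC.
Qed.

Lemma op_ftrunc T N g i :
  T (ftrunc N g) i = \sum_(n < N) mxentry T i n * g n.
Proof.
rewrite linear_sum -dot_ebasis dot_suml; apply: eq_bigr => n _.
by rewrite linearZ dotZl dot_ebasis mulrC.
Qed.

Lemma dot_op_ftrunc T N g y :
  dot (T (ftrunc N g)) y = \sum_(n < N) g n * dot (T (ebasis R n)) y.
Proof.
rewrite linear_sum dot_suml; apply: eq_bigr => n _.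
by rewrite linearZ dotZl.
Qed.

Definition bilform (X : nat -> nat -> R[i]) I N f g : R[i] :=
  \sum_(i < I) \sum_(n < N) X i n * f i * g n.

(** The operator norm of the I x N corner of X, bounded through its bilinear
    form: this is symmetric under transposition and involves finitely many
    entries, so it passes to entrywise limits. *)
Definition section_bound C I N (X : nat -> nat -> R[i]) :=
  forall f g, normc (bilform X I N f g) <= C * (fnorm I f * fnorm N g).

Lemma bilformE X I N f g :
  bilform X I N f g = \sum_(i < I) f i * \sum_(n < N) X i n * g n.
Proof.
apply: eq_bigr => i _; rewrite mulr_sumr; apply: eq_bigr => n _.
by rewrite mulrCA mulrA.
Qed.

Lemma section_bound_op T C I N : 0 <= C ->
  (forall x, l2norm (T x) <= C * l2norm x) -> section_bound C I N (mxentry T).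
Proof.
move=> C0 TC f g; rewrite bilformE; under eq_bigr do rewrite -op_ftrunc.
apply: le_trans (fnorm_CS _ _ _) _; rewrite mulrCA ler_wpM2l//.
by apply: le_trans (fnorm_le_l2norm _ _) _; rewrite -l2norm_ftrunc TC.
Qed.

(** Test the form against the conjugate of the image of g. *)
Lemma section_bound_fnorm X C I N g : 0 <= C -> section_bound C I N X ->
  fnorm I (fun i => \sum_(n < N) X i n * g n) <= C * fnorm N g.
Proof.
move=> C0 XC; set h := fun i => _.
have := XC (fun i => (h i)^*) g; rewrite bilformE fnorm_conj.
under eq_bigr do rewrite -/(h _) mulrC mul_conj_normc.
rewrite -rmorph_sum -fnorm_sq normc_real ?sqr_ge0// => H.
have [->|h0] := eqVneq (fnorm I h) 0; first by rewrite mulr_ge0.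
have hp : 0 < fnorm I h by rewrite lt0r h0 fnorm_ge0.
by rewrite -(ler_pM2l hp) -expr2 mulrCA.
Qed.

(** The i-th row is tested on its own conjugate. *)
Lemma section_bound_row X C i N : 0 <= C -> (forall I N, section_bound C I N X) ->
  fnorm N (X i) <= C.
Proof.
move=> C0 XC; have [->//|h0] := eqVneq (fnorm N (X i)) 0.
have hp : 0 < fnorm N (X i) by rewrite lt0r h0 fnorm_ge0.
rewrite -(ler_pM2r hp).
have := section_bound_fnorm (fun n => (X i n)^*) C0 (XC i.+1 N).
rewrite fnorm_conj; apply: le_trans; rewrite -expr2.
rewrite -ler_sqr ?nnegrE ?fnorm_ge0 ?sqr_ge0// [leRHS]fnorm_sq big_ord_recr /=.
under [X in _ + normc X ^+ 2]eq_bigr do rewrite mul_conj_normc.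
rewrite -rmorph_sum -fnorm_sq normc_real ?sqr_ge0// lerDr.
by apply: sumr_ge0 => j _; exact: sqr_ge0.
Qed.

Lemma linear_op (F : ell2 R -> ell2 R) : linear F -> exists T, T =1 F.
Proof.
move=> linF.
by exists (HB.pack_for (op R) F (GRing.isLinear.Build _ _ _ _ F linF)).
Qed.

(** The rows are square summable, so the coordinates of the image of x are
    inner products with the conjugate rows; the bound on finite sections passes
    to the limit of initial segments of x. *)
Lemma matrix_op (X : nat -> nat -> R[i]) C : 0 <= C ->
  (forall I N, section_bound C I N X) ->
  exists T, (forall x, l2norm (T x) <= C * l2norm x) /\ mxentry T = X.
Proof.
move=> C0 XC.
have row_sq i : (fun n => (X i n)^*) \in @sqsummable R.
  apply: (@bounded_sqsummable _ _ C) => N.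
  by rewrite fnorm_conj; exact: section_bound_row.
pose r i := Ell2 (row_sq i).
have rb x I : fnorm I (fun i => dot x (r i)) <= C * l2norm x.
  have /cvgr_to_le : (fun N => fnorm I (fun i => \sum_(n < N) x n * (r i n)^*))
      @ \oo --> fnorm I (fun i => dot x (r i)).
    apply: (@cvg_fnorm _ _ (fun N i => \sum_(n < N) x n * (r i n)^*)) => i _.
    exact: dot_cvg_sum.
  apply; apply: nearW => N.
  apply: (@le_trans _ _ (C * fnorm N x)).
    apply: le_trans (section_bound_fnorm _ C0 (XC I N)); apply: le_fnorm => i _.
    rewrite le_eqVlt; apply/orP; left; apply/eqP; congr normc.
    by apply: eq_bigr => n _; rewrite /= conjCK mulrC.
  by rewrite ler_wpM2l// fnorm_le_l2norm.
pose F x := Ell2 (bounded_sqsummable (rb x)).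
have [T TF] : exists T, T =1 F.
  by apply: linear_op => a x y; apply: ell2P => i; rewrite /= dotDl dotZl.
exists T; split=> [x|]; first by rewrite TF; apply: l2norm_le => I; exact: rb.
apply/funext => i; apply/funext => n.
by rewrite /mxentry TF /= dotC dot_ebasis /= conjCK.
Qed.

(** Finitely supported vectors are dense, and T is continuous. *)
Lemma op_bound_section T C : 0 <= C -> continuous T ->
  (forall I N, section_bound C I N (mxentry T)) ->
  forall x, l2norm (T x) <= C * l2norm x.
Proof.
move=> C0 /continuous_bounded[D D0 TD] TC x.
apply/ler_addgt0Pr => e e0.
have [N /(_ N (leqnn N)) HN] := ftrunc_dist D0 TD x e0.
rewrite -(subrK (T (ftrunc N x)) (T x)) addrC; apply: le_trans (l2normD _ _) _.
apply: lerD; last exact: ltW.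
apply: (@le_trans _ _ (C * fnorm N x)); last by rewrite ler_wpM2l// fnorm_le_l2norm.
apply: l2norm_le => I; apply: le_trans (section_bound_fnorm _ C0 (TC I N)).
by apply: le_fnorm => i _; rewrite op_ftrunc.
Qed.

Lemma unit_ballP x : unit_ball x <-> l2norm x <= 1.
Proof. by rewrite /unit_ball /= ell2_normE lecR. Qed.

Lemma opnorm_le T C : 0 <= C -> (forall x, l2norm (T x) <= C * l2norm x) ->
  (opnorm T <= C%:E)%E.
Proof.
move=> C0 TC; apply: ge_ereal_sup => _ [x /unit_ballP x1 <-].
by rewrite lee_fin; apply: le_trans (TC x) _; rewrite ler_piMr.
Qed.

Lemma opnorm_bound T C : (opnorm T <= C%:E)%E ->
  forall x, l2norm (T x) <= C * l2norm x.
Proof.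
move=> TC x; have [x0|x0] := eqVneq (l2norm x) 0.
  by rewrite (l2norm_eq0 x0) linear0 l2norm0 mulr0.
have xp : 0 < l2norm x by rewrite lt0r x0 l2norm_ge0.
have nE : normc (l2norm x)^-1%:C%C = (l2norm x)^-1.
  by rewrite normc_real// invr_ge0 l2norm_ge0.
have : (l2norm (T ((l2norm x)^-1%:C%C *: x)))%:E%E \is a fin_num by [].
have : ((l2norm (T ((l2norm x)^-1%:C%C *: x)))%:E <= C%:E)%E.
  apply: le_trans TC; apply: ereal_sup_ubound.
  by exists ((l2norm x)^-1%:C%C *: x) => //; apply/unit_ballP; rewrite l2normZ nE mulVf.
by rewrite lee_fin linearZ l2normZ nE ler_pdivrMl// mulrC.
Qed.

Lemma opnorm_ge0 T : (0 <= opnorm T)%E.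
Proof.
apply: ereal_sup_ubound; exists 0; last by rewrite linear0 l2norm0.
by apply/unit_ballP; rewrite l2norm0.
Qed.

Lemma opnorm_fin_num T : continuous T -> opnorm T \is a fin_num.
Proof.
move=> /continuous_bounded[C C0 TC]; rewrite ge0_fin_numE ?opnorm_ge0//.
by apply: le_lt_trans (opnorm_le C0 TC) _; exact: ltry.
Qed.

End BoundedOperators.

(** * Compact operators *)

Section Compactness.
Variable R : realType.
Implicit Types (x y z : ell2 R) (T S : op R) (C : R).

Definition tail N x : R := l2norm (x - ftrunc N x).

Lemma ftruncB N x y : ftrunc N (x - y)%R = ftrunc N x - ftrunc N y.
Proof.
apply: ell2P => i; rewrite ell2BE !ftruncE.
by case: ifP => _ //; rewrite subr0.
Qed.

Lemma tail_le N x : tail N x <= l2norm x.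
Proof.
rewrite -ler_sqr ?nnegrE ?l2norm_ge0//; apply: le_trans (l2norm_tail x N) _.
by rewrite lerBlDr lerDl sqr_ge0.
Qed.

(** Cutting off the first N coordinates is a linear contraction. *)
Lemma tail_triangle N x y : tail N y <= tail N x + l2norm (x - y).
Proof.
have -> : tail N y = l2norm ((x - ftrunc N x) - ((x - y) - ftrunc N (x - y)%R)).
  congr l2norm; apply: ell2P => i; rewrite !ell2BE ftruncB !ell2BE; ring.
by apply: le_trans (l2normD _ _) _; rewrite l2normN lerD2l tail_le.
Qed.

(** Since the tails of each vector tend to 0, compactness makes the tails
    uniformly small. *)
Lemma compact_op_tail T (e : R) : compact_op T -> 0 < e ->
  exists N, forall x, l2norm x <= 1 -> tail N (T x) <= e.
Proof.
move=> [_ [K TK [/compact_near_coveringP cK _]]] e0.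
have e2 : 0 < e / 2 by rewrite divr_gt0.
have [] := cK nat \oo (fun N y => tail N y <= e) _.
  move=> y _; have [N0 HN0] := ftrunc_cvg y e2.
  exists ([set y' | l2norm (y - y') < e / 2], [set n | (N0 <= n)%N]) => /=.
    split; last by exists N0.
    by apply/nbhs_ell2P; exists (e / 2).
  move=> [y' n] /= [yy' N0n]; apply: le_trans (tail_triangle n y y') _.
  by rewrite [e]splitr lerD// ltW// HN0.
move=> N _ /(_ N (leqnn N)) HN; exists N => x x1; apply: HN.
by apply: TK; exists x => //; apply/unit_ballP.
Qed.

Lemma ultra_bounded_cvg (X : Type) (F : set_system X) (f : X -> R) C :
  UltraFilter F -> F [set x | `|f x| <= C] -> exists l : R, f @ F --> l.
Proof.
move=> UF fC.
have : (f @ F) `[- C, C]%classic.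
  apply: filterS fC => x fx; rewrite /= in_itv /= -ler_norml; exact: fx.
move=> /(@segment_compact R (- C) C (f @ F) _) [l [_ cl]]; exists l => B Bl.
have [//|nB] := in_ultra_setVsetC (f @^-1` B) UF.
by have [z [/= zB]] := cl (~` B) B nB Bl.
Qed.

Lemma tail_anti x : {homo tail^~ x : m n / (m <= n)%N >-> n <= m}.
Proof.
move=> m n mn; apply: le_trans (tail_le n (x - ftrunc m x)).
rewrite /tail ftruncB le_eqVlt; apply/orP; left; apply/eqP; congr l2norm.
apply: ell2P => i; rewrite !(ell2BE, ftruncE); case: ltnP => // ni.
  by rewrite !subrr.
by rewrite ltnNge (leq_trans mn ni) /= !subr0.
Qed.

(** Along an ultrafilter the coordinates converge, and the tails contribute
    arbitrarily little to the distance to the coordinatewise limit. *)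
Lemma compact_uniform_tail C (N : R -> nat) :
  compact [set y : ell2 R | l2norm y <= C /\ forall e : R, 0 < e -> tail (N e) y <= e].
Proof.
set K := [set _ | _]; rewrite compact_ultra => F UF FK.
have coord i : exists l : R[i], forall e : R, 0 < e ->
    \forall y \near F, normc ((y : ell2 R) i - l) < e.
  have [a Fa] : exists a : R, (fun y : ell2 R => complex.Re (y i)) @ F --> a.
    apply: (@ultra_bounded_cvg (ell2 R) F (fun y => complex.Re (y i)) C UF).
    apply: filterS FK => y [yC _].
    exact: le_trans (abs_Re_le _) (le_trans (normc_le_l2norm _ _) yC).
  have [b Fb] : exists b : R, (fun y : ell2 R => complex.Im (y i)) @ F --> b.
    apply: (@ultra_bounded_cvg (ell2 R) F (fun y => complex.Im (y i)) C UF).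
    apply: filterS FK => y [yC _].
    exact: le_trans (abs_Im_le _) (le_trans (normc_le_l2norm _ _) yC).
  exists (Complex a b) => e e0; have e2 : 0 < e / 2 by rewrite divr_gt0.
  move/cvgrPdist_lt : Fa => /(_ _ e2); move/cvgrPdist_lt : Fb => /(_ _ e2).
  apply: filterS2 => y yb ya; rewrite normcB.
  apply: le_lt_trans (normc_le_Re_Im _) _.
  by rewrite [e]splitr; apply: ltrD; rewrite raddfB.
have [l Fl] := choice coord.
have Ffn M (e : R) : 0 < e ->
    \forall y \near F, fnorm M (fun i => (y : ell2 R) i - l i) < e.
  move=> e0; have d0 : 0 < e / M.+1%:R by rewrite divr_gt0// ltr0n.
  have : \forall y \near F, forall i, (i < M)%N ->
      normc ((y : ell2 R) i - l i) < e / M.+1%:R.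
    elim: M {d0} (e / M.+1%:R) (d0) => [|M IHM] d d0; first by apply: nearW.
    near=> y => i; rewrite ltnS leq_eqVlt => /orP[/eqP ->|].
      by near: y; exact: Fl.
    by move: i; near: y; exact: IHM.
  apply: filterS => y yl.
  have : fnorm M (fun i => y i - l i) <= M%:R * (e / M.+1%:R).
    have M0 : 0 <= M%:R * (e / M.+1%:R) by rewrite mulr_ge0// ?ler0n ?(ltW d0).
    rewrite -ler_sqr ?nnegrE ?M0 ?fnorm_ge0//.
    rewrite fnorm_sq exprMn.
    apply: (@le_trans _ _ (\sum_(i < M) (e / M.+1%:R) ^+ 2)).
      apply: ler_sum => i _; rewrite ler_sqr ?nnegrE ?normc_ge0 ?(ltW d0)//; apply: ltW.
      exact: yl.
    rewrite sumr_const card_ord -[leLHS]mulr_natl ler_wpM2r ?sqr_ge0// -natrX ler_nat.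
    by case: (M) => // k; rewrite leq_pmulr.
  move/le_lt_trans; apply; rewrite mulrCA gtr_pMr// ltr_pdivrMr ?ltr0n// mul1r.
  by rewrite ltr_nat.
have lb M : fnorm M l <= C.
  apply/ler_addgt0Pr => e e0.
  have [y [[yC _] yl]] := filter_ex (filterI FK (Ffn M e e0)).
  have := l2normD (ftrunc M y) (ftrunc M (fun i => l i - y i)).
  have -> : ftrunc M y + ftrunc M (fun i => l i - y i) = ftrunc M l.
    apply: ell2P => i; rewrite ell2DE !ftruncE; case: ifP => _; last by rewrite addr0.
    by rewrite addrC subrK.
  rewrite !l2norm_ftrunc => /le_trans; apply; apply: lerD.
    exact: le_trans (fnorm_le_l2norm _ _) yC.
  apply: ltW; apply: le_lt_trans yl; apply: le_fnorm => i _.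
  by rewrite normcB.
pose L := Ell2 (bounded_sqsummable lb).
have FL (e : R) : 0 < e -> \forall y \near F, l2norm (L - y) < e.
  move=> e0; have e4 : 0 < e / 4 by rewrite divr_gt0.
  have [M HM] := ftrunc_cvg L e4.
  pose m := maxn M (N (e / 4)).
  near=> y.
  have -> : L - y = (L - ftrunc m L) - (y - ftrunc m y) - ftrunc m (fun i => y i - l i).
    apply: ell2P => i; rewrite !ell2BE !ftruncE /=; case: ifP => _; ring.
  apply: le_lt_trans (l2normD _ _) _.
  rewrite l2normN l2norm_ftrunc.
  have h1 : fnorm m (fun i => y i - l i) < e / 4 by near: y; exact: Ffn.
  have h2 : l2norm (L - ftrunc m L) < e / 4 by apply: HM; exact: leq_maxl.
  have h3 : tail m y <= e / 4.
    apply: le_trans (tail_anti y (leq_maxr M (N (e / 4)))) _; have [_] : K y by near: y.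
    exact.
  have := l2normD (L - ftrunc m L) (- (y - ftrunc m y)); rewrite l2normN.
  rewrite -/(tail m y) => h4; lra.
exists L; split.
  split; first by apply: l2norm_le => M; exact: lb.
  move=> e e0; apply/ler_addgt0Pr => d d0.
  have [y [[_ yT] yL]] := filter_ex (filterI FK (FL d d0)).
  apply: le_trans (tail_triangle _ y L) _; apply: lerD; first exact: yT.
  by rewrite l2normB ltW.
by move=> A /nbhs_ell2P[e e0 eA]; apply: filterS (FL e e0).
Unshelve. all: by end_near. Qed.

Lemma tail_compact_op T : continuous T ->
  (forall e : R, 0 < e -> exists N, forall x, l2norm x <= 1 -> tail N (T x) <= e) ->
  compact_op T.
Proof.
move=> cT tT; split=> //.
have [C C0 TC] := continuous_bounded cT.
have [N HN] : {N : R -> nat & forall e : R, 0 < e ->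
    forall x, l2norm x <= 1 -> tail (N e) (T x) <= e}.
  apply: (@choice R nat (fun e N => 0 < e -> forall x, l2norm x <= 1 -> tail N (T x) <= e)).
  by move=> e; case: (ltrP 0 e) => [/tT[N HN]|_]; [exists N|exists 0%N].
have cK := compact_precompact (@norm_hausdorff _ (ell2 R)) (@compact_uniform_tail C N).
apply: (precompact_subset _ cK) => _ [x /unit_ballP x1 <-].
split; last by move=> e e0; exact: HN.
by apply: le_trans (TC x) _; rewrite ler_piMr.
Qed.

End Compactness.

(** * Square roots and the existence of the absolute value *)

Section SquareRoot.
Variable R : realType.
Implicit Types (x y z : ell2 R) (T S P D : op R) (C : R).

Lemma le0_of_vanishing (e : nat -> R) (K r : R) : e @ \oo --> 0 ->
  (forall n, r <= e n * K) -> r <= 0.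
Proof.
move=> e0 re.
have : (fun n => e n * K) @ \oo --> 0 * K by apply: cvgM e0 _; exact: cvg_cst.
rewrite mul0r => /cvgr_to_ge; apply; exact: nearW.
Qed.

Lemma eq_of_vanishing (e : nat -> R) (K : R) x y : e @ \oo --> 0 ->
  (forall n, l2norm (x - y) <= e n * K) -> x = y.
Proof.
move=> e0 /(le0_of_vanishing e0) xy; apply/eqP; rewrite -subr_eq0; apply/eqP.
by apply: l2norm_eq0; apply/eqP; rewrite eq_le xy l2norm_ge0.
Qed.

(** The n-th coordinate of S y has to be the inner product of y with T e_n.
    Pairing the first N of these numbers with themselves gives the inner product
    of y with the image under T of a truncated vector, whence a bound
    independent of N. *)
Lemma adjoint_exists T : continuous T -> exists S, is_adjoint T S.
Proof.
move=> /continuous_bounded[C C0 TC].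
have Sb y N : fnorm N (fun n => dot y (T (ebasis R n))) <= C * l2norm y.
  set h := fun n => _.
  have [->|h0] := eqVneq (fnorm N h) 0; first by rewrite mulr_ge0 ?l2norm_ge0.
  have hp : 0 < fnorm N h by rewrite lt0r h0 fnorm_ge0.
  rewrite -(ler_pM2l hp) -expr2.
  have -> : fnorm N h ^+ 2 = normc (dot (T (ftrunc N h)) y).
    rewrite dot_op_ftrunc; under eq_bigr do rewrite (dotC y) -/(h _) mul_conj_normc.
    by rewrite -rmorph_sum -fnorm_sq normc_real ?sqr_ge0.
  apply: le_trans (dot_CS _ _) _; rewrite mulrA [_ * C]mulrC ler_wpM2r ?l2norm_ge0//.
  by apply: le_trans (TC _) _; rewrite l2norm_ftrunc.
have [S SE] : exists S : op R, S =1 (fun y => Ell2 (bounded_sqsummable (Sb y))).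
  by apply: linear_op => a x y; apply: ell2P => i; rewrite /= dotDl dotZl.
exists S => x y; apply/esym; apply: dotP; apply/cvg_normcP => e e0.
have y1 : 0 < l2norm y + 1 by rewrite ltr_wpDl ?l2norm_ge0.
have [N HN] := ftrunc_dist C0 TC x (divr_gt0 e0 y1).
exists N => // n /HN xn.
have -> : \sum_(i < n) x i * (S y i)^* = dot (T (ftrunc n x)) y.
  by rewrite dot_op_ftrunc; apply: eq_bigr => i _; rewrite SE /= -dotC.
rewrite -dotBl; apply: le_lt_trans (dot_CS _ _) _.
apply: (@le_lt_trans _ _ (l2norm (T x - T (ftrunc n x)) * (l2norm y + 1))).
  by rewrite ler_wpM2l ?l2norm_ge0// lerDl.
by rewrite -ltr_pdivlMr.
Qed.

Definition symmetric_op (F : ell2 R -> ell2 R) := forall x y, dot (F x) y = dot x (F y).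

(** For a symmetric contraction D, a solution Y of 2 Y = D + Y^2 satisfies
    (1 - Y)^2 = 1 - D.  The iterates
    X_(n+1) = (D + X_n^2) / 2 are polynomials in D with nonnegative
    coefficients, so that the same iteration for the scalar D = 1 controls the
    increments of X_n in norm. *)
Section Iteration.
Variable D : op R.
Hypothesis D1 : forall x, l2norm (D x) <= l2norm x.
Hypothesis Dsym : symmetric_op D.

Fixpoint sqrt_iter n x : ell2 R :=
  if n is n'.+1 then 2^-1 *: (D x + sqrt_iter n' (sqrt_iter n' x)) else 0.
Local Notation X := sqrt_iter.

Fixpoint sqrt_rate n : R := if n is n'.+1 then 2^-1 * (1 + sqrt_rate n' ^+ 2) else 0.
Local Notation a := sqrt_rate.

Lemma sqrt_iter_linear n : linear (X n).
Proof.
elim: n => [|n IHn] c x y /=; first by rewrite scaler0 addr0.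
rewrite linearP !IHn !scalerDr !scalerA !(mulrC 2^-1) -!addrA; congr (_ + _).
by rewrite addrCA.
Qed.

Lemma sqrt_iterD n x y : X n (x + y) = X n x + X n y.
Proof. by have := sqrt_iter_linear n 1 x y; rewrite !scale1r. Qed.

Lemma sqrt_iter0 n : X n 0 = 0.
Proof. by have := sqrt_iterD n 0 0; rewrite addr0 -{1}[X n 0]addr0 => /addrI. Qed.

Lemma sqrt_iterZ n c x : X n (c *: x) = c *: X n x.
Proof. by have := sqrt_iter_linear n c x 0; rewrite sqrt_iter0 !addr0. Qed.

Lemma sqrt_iterB n x y : X n (x - y) = X n x - X n y.
Proof. by rewrite -scaleN1r sqrt_iterD sqrt_iterZ scaleN1r. Qed.

Lemma sqrt_iter_sym n : symmetric_op (X n).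
Proof.
elim: n => [|n IHn] x y /=; first by rewrite dot0l dot0r.
by rewrite dotZl dotZr !dotDl !dotDr Dsym !IHn rmorphV ?unitfE// rmorph_nat.
Qed.

Lemma sqrt_iter_comm (G : ell2 R -> ell2 R) : linear G ->
  (forall x, G (D x) = D (G x)) -> forall n x, G (X n x) = X n (G x).
Proof.
move=> linG GD.
have GDD x y : G (x + y) = G x + G y by have := linG 1 x y; rewrite !scale1r.
have G0 : G 0 = 0 by have := GDD 0 0; rewrite addr0 -{1}[G 0]addr0 => /addrI.
have GZ c x : G (c *: x) = c *: G x by have := linG c x 0; rewrite G0 !addr0.
by elim=> [|n IHn] x /=; rewrite ?G0// GZ GDD GD !IHn.
Qed.

Lemma sqrt_iter_commD n x : X n (D x) = D (X n x).
Proof. by rewrite (sqrt_iter_comm _ (fun=> erefl))// => c u v; rewrite linearP. Qed.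

Lemma sqrt_iter_commX m n x : X m (X n x) = X n (X m x).
Proof.
apply: sqrt_iter_comm => [|z]; [exact: sqrt_iter_linear|exact: sqrt_iter_commD].
Qed.

Lemma sqrt_rate_bounds n : 0 <= a n <= 1.
Proof.
elim: n => [|n /andP[a0 a1]] /=; first by rewrite lexx ler01.
have : a n ^+ 2 <= 1 by rewrite expr_le1.
have := sqr_ge0 (a n); move: (a n ^+ 2) => b b0 b1; apply/andP; split; lra.
Qed.

Lemma sqrt_rateS n : a n <= a n.+1.
Proof. by rewrite /=; have := sqr_ge0 (1 - a n); rewrite !expr2; lra. Qed.

Lemma sqrt_rate_cvg : a @ \oo --> limn a.
Proof.
apply: (@nondecreasing_is_cvgn R); first by apply/nondecreasing_seqP; exact: sqrt_rateS.
by exists 1 => _ [n _ <-]; case/andP: (sqrt_rate_bounds n).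
Qed.

Lemma normc_half : normc (2^-1 : R[i]) = 2^-1.
Proof. by rewrite Normc.normcV -(rmorph_nat (real_complex R)) normc_real ?ler0n. Qed.

Lemma sqrt_iter_bound n x : l2norm (X n x) <= a n * l2norm x.
Proof.
elim: n x => [|n IHn] x /=; first by rewrite l2norm0 mul0r.
have /andP[a0 a1] := sqrt_rate_bounds n.
rewrite l2normZ normc_half -mulrA ler_wpM2l ?invr_ge0//.
apply: le_trans (l2normD _ _) _; rewrite mulrDl mul1r; apply: lerD; first exact: D1.
apply: le_trans (IHn _) _; rewrite expr2 -mulrA ler_wpM2l//.
Qed.

(** X_(n+1) and X_n commute, so X_(n+1)^2 - X_n^2 is the product of their
    difference and their sum; the scalar rates satisfy the same identity. *)
Lemma sqrt_iter_step n x : l2norm (X n.+1 x - X n x) <= (a n.+1 - a n) * l2norm x.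
Proof.
elim: n x => [|n IHn] x.
  rewrite /= !subr0 addr0 expr0n addr0 mulr1 l2normZ normc_half.
  by rewrite ler_wpM2l ?invr_ge0// D1.
have -> : X n.+2 x - X n.+1 x =
    2^-1 *: (X n.+1 (X n.+1 x + X n x) - X n (X n.+1 x + X n x)).
  rewrite !sqrt_iterD (sqrt_iter_commX n.+1 n x) -/(X n.+1 _).
  rewrite {1}[X n.+2 x]/= -/(X n.+1 x) {2}[X n.+1 x]/= -scalerBr; congr (_ *: _).
  by rewrite -/(X n.+1 _); ell2_ring.
rewrite l2normZ normc_half; apply: le_trans (ler_wpM2l _ (IHn _)) _; rewrite ?invr_ge0//.
have an := sqrt_rateS n.
have h : l2norm (X n.+1 x + X n x) <= (a n.+1 + a n) * l2norm x.
  by apply: le_trans (l2normD _ _) _; rewrite mulrDl lerD// sqrt_iter_bound.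
have := ler_wpM2l (_ : 0 <= 2^-1 * (a n.+1 - a n)) h.
rewrite -!mulrA => /(_ _)/le_trans; apply.
  by rewrite mulr_ge0 ?invr_ge0 ?subr_ge0.
rewrite -[a n.+2]/(2^-1 * (1 + a n.+1 ^+ 2)) {4}[a n.+1]/= le_eqVlt; apply/orP; left.
by apply/eqP; rewrite -[sqrt_rate n]/(a n); ring.
Qed.

Lemma sqrt_iter_cauchy m n x : (n <= m)%N ->
  l2norm (X m x - X n x) <= (limn a - a n) * l2norm x.
Proof.
move=> nm; apply: (@le_trans _ _ ((a m - a n) * l2norm x)); last first.
  rewrite ler_wpM2r ?l2norm_ge0// lerD2r; apply: nondecreasing_cvgn_le.
    by apply/nondecreasing_seqP; exact: sqrt_rateS.
  by apply: cvgP sqrt_rate_cvg.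
rewrite -(subnK nm); elim: (m - n)%N => [|k IHk].
  by rewrite !subrr l2norm0 mul0r.
rewrite addSn.
rewrite (_ : _ - _ = (X (k + n).+1 x - X (k + n) x) + (X (k + n) x - X n x)); last first.
  by rewrite addrA subrK.
apply: le_trans (l2normD _ _) _; apply: le_trans (lerD (sqrt_iter_step _ _) IHk) _.
by rewrite -mulrDl addrA subrK.
Qed.

Lemma sqrt_fixpoint : exists Y : op R,
  [/\ forall x, l2norm (Y x) <= l2norm x, symmetric_op Y &
      forall x, Y x + Y x = D x + Y (Y x)].
Proof.
pose e n := limn a - a n.
have e0 : e @ \oo --> 0.
  by rewrite -(subrr (limn a)); apply: cvgB; [exact: cvg_cst|exact: sqrt_rate_cvg].
have ex x : exists y, forall n, l2norm (y - X n x) <= e n * l2norm x.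
  apply: ell2_complete => [|m n]; last exact: sqrt_iter_cauchy.
  by rewrite -(mul0r (l2norm x)); apply: cvgM => //; exact: cvg_cst.
have [F HF] := choice ex.
have [Y YF] : exists Y : op R, Y =1 F.
  apply: linear_op => c x y; apply: (eq_of_vanishing e0) => n.
  rewrite (_ : _ - _ = (F (c *: x + y) - X n (c *: x + y))
      - c *: (F x - X n x) - (F y - X n y)); last first.
    rewrite sqrt_iterD sqrt_iterZ; ell2_ring.
  apply: le_trans (l2normD _ _) _; rewrite l2normN.
  apply: le_trans (lerD (l2normD _ _) (HF _ _)) _; rewrite l2normN l2normZ.
  apply: le_trans (lerD (lerD (HF _ _) (ler_wpM2l (normc_ge0 _) (HF _ _))) (lexx _)) _.
  rewrite mulrCA -!mulrDr; exact: lexx.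
have HY x n : l2norm (Y x - X n x) <= e n * l2norm x by rewrite YF.
exists Y; split=> [x|x y|x].
- rewrite -subr_le0; apply: (le0_of_vanishing e0 (K := l2norm x)) => n.
  apply: le_trans (HY x n); rewrite lerBlDr -lerBlDl.
  have /andP[_ a1] := sqrt_rate_bounds n.
  have := sqrt_iter_bound n x; have := l2normD (Y x - X n x) (X n x).
  rewrite subrK; have : a n * l2norm x <= l2norm x by rewrite ler_piMl ?l2norm_ge0.
  lra.
- apply/eqP; rewrite -subr_eq0; apply/eqP; apply: Normc.eq0_normc.
  apply/eqP; rewrite eq_le normc_ge0 andbT.
  apply: (le0_of_vanishing e0 (K := 2 * (l2norm x * l2norm y))) => n.
  rewrite (_ : _ - _ = dot (Y x - X n x) y - dot x (Y y - X n y)); last first.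
    by rewrite dotBl dotBr sqrt_iter_sym; ring.
  apply: le_trans (le_normcD _ _) _; rewrite normcN.
  apply: le_trans (lerD (dot_CS _ _) (dot_CS _ _)) _.
  apply: le_trans (lerD (ler_wpM2r (l2norm_ge0 _) (HY x n))
    (ler_wpM2l (l2norm_ge0 _) (HY y n))) _.
  by rewrite le_eqVlt; apply/orP; left; apply/eqP; ring.
- have e0' : (fun n => e n.+1 + e n) @ \oo --> 0.
    by rewrite -(addr0 0); have := e0; rewrite -cvg_shiftS => e1; exact: cvgD e1 e0.
  apply: (eq_of_vanishing e0' (K := 2 * l2norm x + l2norm (Y x) + l2norm x)) => n.
  have E n0 : X n0.+1 x + X n0.+1 x = D x + X n0 (X n0 x).
    by rewrite /= -scalerDl -mulr2n -[_ *+ 2]mulr_natl divff// scale1r.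
  rewrite (_ : _ - _ = (Y x - X n.+1 x) + (Y x - X n.+1 x)
      - ((Y (Y x) - X n (Y x)) + X n (Y x - X n x))); last first.
    rewrite sqrt_iterB; have := E n => /(congr1 (fun z => Y x + Y x - z)).
    move=> En; apply: (addIr (D x + X n (X n x))); rewrite -[in RHS]E.
    ell2_ring.
  have /andP[a0' a1'] := sqrt_rate_bounds n.
  have en m : 0 <= e m.
    rewrite subr_ge0; apply: nondecreasing_cvgn_le.
      by apply/nondecreasing_seqP; exact: sqrt_rateS.
    by apply: cvgP sqrt_rate_cvg.
  have h1 := HY x n.+1; have h2 := HY (Y x) n.
  have h3 : l2norm (X n (Y x - X n x)) <= e n * l2norm x.
    apply: le_trans (sqrt_iter_bound _ _) _; apply: le_trans (HY x n).
    by rewrite ler_piMl ?l2norm_ge0.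
  apply: le_trans (l2normD _ _) _; rewrite l2normN.
  apply: le_trans (lerD (l2normD _ _) (l2normD _ _)) _.
  have : 0 <= e n * (2 * l2norm x) by rewrite !mulr_ge0 ?l2norm_ge0.
  have : 0 <= e n.+1 * (l2norm (Y x) + l2norm x).
    by rewrite (mulr_ge0 (en _))// addr_ge0 ?l2norm_ge0.
  clearbody e; rewrite !mulrDl !mulrDr; lra.
Qed.

End Iteration.

Lemma conj_realC (r : R) : (r%:C%C)^* = r%:C%C.
Proof. exact: conjc_real. Qed.

Lemma complex_realE (z : R[i]) : z^* = z -> z = (complex.Re z)%:C%C.
Proof. by move=> zz; rewrite RRe_real//; apply/CrealP. Qed.

(** If |T x| <= C |x|, then |S T x| <= C |T x| for the adjoint S of T, so
    D = 1 - S T / C^2 is a contraction, and C (1 - Y) is a square root of S T. *)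
Lemma op_abs_exists T : continuous T -> exists P, is_abs T P.
Proof.
move=> cT; have [C' C'0 TC'] := continuous_bounded cT.
have [C C0 TC] : exists2 C, 0 < C & forall x, l2norm (T x) <= C * l2norm x.
  exists (C' + 1); first by rewrite ltr_wpDl.
  by move=> x; apply: le_trans (TC' x) _; rewrite ler_wpM2r ?l2norm_ge0// lerDl.
have [S TS] := adjoint_exists cT.
have STC x : l2norm (S (T x)) <= C * l2norm (T x).
  have [->|h0] := eqVneq (l2norm (S (T x))) 0; first by rewrite mulr_ge0 ?l2norm_ge0 ?ltW.
  have hp : 0 < l2norm (S (T x)) by rewrite lt0r h0 l2norm_ge0.
  rewrite -(ler_pM2l hp) -expr2.
  have -> : l2norm (S (T x)) ^+ 2 = normc (dot (T (S (T x))) (T x)).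
    by rewrite TS dot_self normc_real ?sqr_ge0.
  apply: le_trans (dot_CS _ _) _; rewrite mulrA [_ * C]mulrC.
  by rewrite ler_wpM2r ?l2norm_ge0.
have TS' x y : dot (S x) y = dot x (T y) by rewrite dotC -TS -dotC.
have STd x : dot (S (T x)) x = (l2norm (T x) ^+ 2)%:C%C.
  by rewrite dotC -TS -dotC dot_self.
pose k : R[i] := (C ^- 2)%:C%C.
have k0 : C ^- 2 * C ^+ 2 = 1 by rewrite mulVf// expf_neq0// gt_eqF.
have [D DE] : exists D : op R, D =1 (fun x => x - k *: S (T x)).
  apply: linear_op => c x y; rewrite !linearP /=; ell2_ring.
have D1 x : l2norm (D x) <= l2norm x.
  rewrite -ler_sqr ?nnegrE ?l2norm_ge0// -lecR -!dot_self DE.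
  have ST2 : C ^- 2 * (C ^- 2 * l2norm (S (T x)) ^+ 2) <= C ^- 2 * l2norm (T x) ^+ 2.
    rewrite ler_wpM2l ?invr_ge0 ?sqr_ge0//.
    rewrite ler_pdivrMl ?exprn_gt0// -exprMn ler_sqr ?nnegrE ?l2norm_ge0 ?STC//.
    by rewrite mulr_ge0 ?l2norm_ge0 ?ltW.
  have kT : 0 <= C ^- 2 * l2norm (T x) ^+ 2 by rewrite mulr_ge0 ?invr_ge0 ?sqr_ge0.
  rewrite dotBl !dotBr !dotZl !dotZr (dotC (S _) x) STd !dot_self !conj_realC /k.
  rewrite -!rmorphM -!rmorphB lecR; lra.
have Dsym : symmetric_op D.
  by move=> x y; rewrite !DE dotBl dotBr dotZl dotZr conj_realC TS' TS.
have [Y [Y1 Ysym YE]] := sqrt_fixpoint D1 Dsym.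
have [P PE] : exists P : op R, P =1 (fun x => C%:C%C *: (x - Y x)).
  apply: linear_op => c x y; rewrite !linearP /=; ell2_ring.
exists P; split.
- apply: (@bounded_continuous _ _ (C * 2)) => x.
  rewrite PE l2normZ normc_real ?(ltW C0)// -mulrA ler_wpM2l ?(ltW C0)//.
  apply: le_trans (l2normD _ _) _; rewrite l2normN mulrDl mul1r lerD2l; exact: Y1.
- move=> x; rewrite PE dotZl dotBl mulr_ge0 ?ler0c ?(ltW C0)// dot_self.
  have -> : dot (Y x) x = (complex.Re (dot (Y x) x))%:C%C.
    by apply: complex_realE; rewrite -dotC Ysym.
  rewrite -rmorphB ler0c subr_ge0; apply: le_trans (Re_le_normc _) _.
  by apply: le_trans (dot_CS _ _) _; rewrite expr2 ler_wpM2r ?l2norm_ge0.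
- exists S => // x; rewrite !PE !(linearZ, linearB) /=.
  have YY : Y (Y x) = Y x + Y x - D x by rewrite YE addrC addKr.
  rewrite YY DE.
  transitivity ((C%:C%C ^+ 2 * k) *: S (T x)); first by ell2_ring.
  by rewrite /k -rmorphXn -rmorphM mulrC k0 scale1r.
Qed.

End SquareRoot.

(** * Schatten norms of exponents 1 and 2 *)

Section SchattenNorms.
Variable R : realType.
Implicit Types (x y z : ell2 R) (T S P : op R).

Lemma op_absP T : continuous T -> is_abs T (op_abs T).
Proof. by move=> cT; apply: xgetPex; exact: op_abs_exists. Qed.

(** Polarization: the form of P is real on x + y and on x + i y. *)
Lemma positive_symmetric P : positive_op P -> symmetric_op P.
Proof.
move=> P0 x y; rewrite [RHS]dotC.
have Im0 z : complex.Im (dot (P z) z) = 0 by apply: ger0_Im; exact: P0.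
have h1 : complex.Im (dot (P x) y + dot (P y) x) = 0.
  have := Im0 (x + y); rewrite linearD !dotDl !dotDr.
  by move: (Im0 x) (Im0 y); rewrite !raddfD /= => -> ->; rewrite add0r addr0.
have h2 : complex.Im ('i%C * (dot (P y) x - dot (P x) y)) = 0.
  have := Im0 (x + 'i%C *: y); rewrite linearD linearZ !dotDl !dotDr !dotZl !dotZr.
  have -> : ('i%C : R[i])^* = - 'i%C by apply/eqP; rewrite eq_complex /= oppr0 !eqxx.
  have -> : 'i%C * (- 'i%C * dot (P y) y) = dot (P y) y :> R[i].
    by rewrite mulrA mulrN -expr2 sqr_i opprK mul1r.
  move: (Im0 x) (Im0 y); rewrite mulrBr mulNr !raddfD /= => -> ->; rewrite add0r addr0.
  by rewrite addrC.
move: (dot (P x) y) (dot (P y) x) h1 h2 => [a b] [c d] /= h1.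
rewrite !mul0r !add0r !mul1r => h2.
apply/eqP; rewrite eq_complex /=; apply/andP; split; apply/eqP; lra.
Qed.

(** The squares of both sides are the inner product of S T x = P^2 x with x. *)
Lemma l2norm_abs T P : is_abs T P -> forall x, l2norm (P x) = l2norm (T x).
Proof.
move=> [_ /positive_symmetric Psym [S TS PP]] x.
have : dot (P x) (P x) = dot (T x) (T x) by rewrite -Psym PP dotC -TS -dotC.
rewrite !dot_self => /complexI h; apply/eqP.
by rewrite -(@eqrXn2 _ 2) ?l2norm_ge0// h.
Qed.

(** The Schatten 2-norm is the Hilbert-Schmidt norm. *)
Lemma trace_abs2E T : continuous T ->
  trace_abs_pow 2 T = (\sum_(0 <= n <oo) (l2norm (T (ebasis R n)) ^+ 2)%:E)%E.
Proof.
move=> /op_absP cT; apply: eq_eseriesr => n _.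
have [_ /positive_symmetric Psym _] := cT.
by rewrite /= -dot_ebasis Psym dot_self -(l2norm_abs cT).
Qed.

Lemma trace_abs1_term_ge0 T n : continuous T ->
  0 <= complex.Re (op_abs T (ebasis R n) n).
Proof.
move=> /op_absP[_ P0 _]; have := P0 (ebasis R n).
by rewrite dot_ebasis lecE => /andP[].
Qed.

Lemma trace_abs1_ge0 T : continuous T -> (0 <= trace_abs_pow 1 T)%E.
Proof.
by move=> cT; apply: nneseries_ge0 => n _ _; rewrite lee_fin trace_abs1_term_ge0.
Qed.

Lemma trace_abs1_ge T N : continuous T ->
  ((\sum_(n < N) complex.Re (op_abs T (ebasis R n) n))%:E <= trace_abs_pow 1 T)%E.
Proof.
move=> cT; rewrite -sumEFin.
have := @nneseries_lim_ge R (fun n => (complex.Re (op_abs T (ebasis R n) n))%:E)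
  xpredT 0%N N.
by rewrite big_mkord; apply => n _ _; rewrite lee_fin trace_abs1_term_ge0.
Qed.

Lemma trace_abs1_le T (c : R) : continuous T ->
  (forall N, \sum_(n < N) complex.Re (op_abs T (ebasis R n) n) <= c) ->
  (trace_abs_pow 1 T <= c%:E)%E.
Proof.
move=> cT Tc; apply: lime_le.
  by apply: is_cvg_nneseries => n _ _; rewrite lee_fin trace_abs1_term_ge0.
by apply: nearW => N; rewrite big_mkord sumEFin lee_fin; exact: Tc.
Qed.

Lemma schatten_norm1E T : continuous T -> schatten_norm 1 T = trace_abs_pow 1 T.
Proof. by move=> cT; rewrite /schatten_norm invr1 poweRe1// trace_abs1_ge0. Qed.

Lemma schatten2_le T (h : R) : continuous T -> 0 <= h ->
  (forall N, \sum_(n < N) l2norm (T (ebasis R n)) ^+ 2 <= h ^+ 2) ->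
  schatten 2 T /\ (schatten_norm 2 T <= h%:E)%E.
Proof.
move=> cT h0 Th.
have tr0 : (0 <= trace_abs_pow 2 T)%E.
  by rewrite trace_abs2E//; apply: nneseries_ge0 => n _ _; rewrite lee_fin sqr_ge0.
have trh : (trace_abs_pow 2 T <= (h ^+ 2)%:E)%E.
  rewrite trace_abs2E//; apply: lime_le.
    by apply: is_cvg_nneseries => n _ _; rewrite lee_fin sqr_ge0.
  by apply: nearW => N; rewrite big_mkord sumEFin lee_fin; exact: Th.
suff sh : (schatten_norm 2 T <= h%:E)%E.
  by split=> //; split=> //; exact: le_lt_trans sh (ltry _).
rewrite /schatten_norm; case: (trace_abs_pow 2 T) tr0 trh => [t| |]//=.
rewrite !lee_fin => t0 th; rewrite powR12_sqrt//.
by rewrite -[leRHS]ger0_norm// -sqrtr_sqr ler_wsqrtr.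
Qed.

Lemma schatten2_hs T : schatten 2 T -> exists h : R,
  [/\ 0 <= h, schatten_norm 2 T = h%:E &
      forall N, \sum_(n < N) l2norm (T (ebasis R n)) ^+ 2 <= h ^+ 2].
Proof.
move=> [cT]; rewrite /schatten_norm.
have tr0 : (0 <= trace_abs_pow 2 T)%E.
  by rewrite trace_abs2E//; apply: nneseries_ge0 => n _ _; rewrite lee_fin sqr_ge0.
have trN N : ((\sum_(n < N) l2norm (T (ebasis R n)) ^+ 2)%:E <= trace_abs_pow 2 T)%E.
  rewrite trace_abs2E// -sumEFin.
  have := @nneseries_lim_ge R (fun n => (l2norm (T (ebasis R n)) ^+ 2)%:E)
  xpredT 0%N N.
  by rewrite big_mkord; apply => n _ _; rewrite lee_fin sqr_ge0.
case: (trace_abs_pow 2 T) tr0 trN => [t| |]//= ; last first.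
  by rewrite invr_eq0 pnatr_eq0.
rewrite lee_fin => t0 tN _; exists (Num.sqrt t); split => // [|N].
  by rewrite powR12_sqrt.
by rewrite sqr_sqrtr//; have := tN N; rewrite lee_fin.
Qed.

End SchattenNorms.

(** * Trace duality on finite sections *)

Section TraceDuality.
Variable R : realType.
Implicit Types (x y z : ell2 R) (T S P : op R).
Local Notation C := R[i].

(** The vectors v_l are the rows of the unitary matrix of the spectral theorem.
    Both orthogonality relations are kept: the rows are orthonormal, and so are
    the columns, which is what makes traces and norms independent of the basis. *)
Lemma spectral_basis N (s : nat -> nat -> C) : (forall i j, s j i = (s i j)^*) ->
  exists v : 'I_N -> nat -> C,
  [/\ forall i j : 'I_N, \sum_l v l i * (v l j)^* = (i == j)%:R,
      forall l m, \sum_(i < N) v l i * (v m i)^* = (l == m)%:R &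
      forall l m, l != m ->
        \sum_(i < N) \sum_(j < N) v l i * (v m j)^* * s i j = 0].
Proof.
move=> sherm; pose G : 'M[C]_N := \matrix_(i, j) s i j.
have Gn : G \is normalmx.
  apply: hermitian_normalmx; apply/is_hermitianmxP; rewrite expr0 scale1r.
  by apply/matrixP => i j; rewrite !mxE -sherm.
have /orthomx_spectralP GE := Gn.
set U := spectralmx G in GE; set D := spectral_diag G in GE.
have Uu : U \is unitarymx by exact: spectral_unitarymx.
exists (fun l n => if insub n is Some i then U l i else 0); split.
- move=> i j; have Uu' : U^T \is unitarymx by rewrite trmx_unitary.
  have /unitarymxP/matrixP/(_ i j) := Uu'; rewrite !mxE => <-.
  by apply: eq_bigr => l _; rewrite !valK !mxE.
- move=> l m; have /unitarymxP/matrixP/(_ l m) := Uu; rewrite !mxE => <-.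
  by apply: eq_bigr => i _; rewrite !valK !mxE.
- move=> l m lm.
  have : U *m G *m (map_mx Num.conj U^T) = diag_mx D.
    by rewrite GE !mulmxA mulmxV ?unitarymx_unit// mul1mx -mulmxA (unitarymxP Uu) mulmx1.
  move=> /matrixP/(_ l m); rewrite !mxE (negbTE lm) mulr0n => h; rewrite -[RHS]h.
  rewrite exchange_big /=; apply: eq_bigr => j _.
  rewrite !mxE mulr_suml; apply: eq_bigr => i _.
  by rewrite !valK !mxE mulrAC.
Qed.

Lemma dot_ftrunc N g x : dot (ftrunc N g) x = \sum_(n < N) g n * (x n)^*.
Proof.
rewrite dot_suml; apply: eq_bigr => n _.
by rewrite dotZl [dot _ _]dotC dot_ebasis.
Qed.

Lemma sum_delta N (F : 'I_N -> C) (i : 'I_N) : \sum_j (i == j)%:R * F j = F i.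
Proof.
rewrite (bigD1 i)//= eqxx mul1r big1 ?addr0// => j ji.
by rewrite eq_sym (negbTE ji) mul0r.
Qed.

Lemma trace_invariance N (v : 'I_N -> nat -> C) (t : nat -> nat -> C) :
  (forall i j : 'I_N, \sum_l v l i * (v l j)^* = (i == j)%:R) ->
  \sum_(n < N) t n n =
  \sum_l \sum_(i < N) \sum_(j < N) v l i * (v l j)^* * t i j.
Proof.
move=> vv; rewrite exchange_big /=; apply: eq_bigr => i _.
rewrite exchange_big /= -[LHS](sum_delta (fun j : 'I_N => t i j) i).
by apply: eq_bigr => j _; rewrite -mulr_suml vv.
Qed.

(** Invariance of the trace of the rank one form g g^*. *)
Lemma parseval N (v : 'I_N -> nat -> C) (g : nat -> C) :
  (forall i j : 'I_N, \sum_l v l i * (v l j)^* = (i == j)%:R) ->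
  \sum_l normc (\sum_(n < N) v l n * g n) ^+ 2 = fnorm N g ^+ 2.
Proof.
move=> vv; apply: complexI; rewrite fnorm_sq !rmorph_sum /=.
under [RHS]eq_bigr do rewrite -mul_conj_normc.
rewrite (trace_invariance (fun i j => g i * (g j)^*) vv).
apply: eq_bigr => l _; rewrite -mul_conj_normc rmorph_sum mulr_suml.
apply: eq_bigr => i _; rewrite mulr_sumr; apply: eq_bigr => j _.
by rewrite rmorphM /=; ring.
Qed.

(** Expand the square of the distance from x to the sum of the c_l w_l, with
    c_l the inner product of x and w_l. The w_l have norm at most 1 rather than 1
    since they will be normalized images, some of which vanish. *)
Lemma bessel N (w : 'I_N -> ell2 R) x :
  (forall l m, l != m -> dot (w l) (w m) = 0) -> (forall l, l2norm (w l) <= 1) ->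
  \sum_l normc (dot x (w l)) ^+ 2 <= l2norm x ^+ 2.
Proof.
move=> wort w1; pose c l := dot x (w l).
pose y := \sum_l c l *: w l.
have xy : dot x y = (\sum_l normc (c l) ^+ 2)%:C%C.
  rewrite dot_sumr rmorph_sum; apply: eq_bigr => l _.
  by rewrite dotZr -/(c l) mulrC mul_conj_normc.
have yy : dot y y = (\sum_l normc (c l) ^+ 2 * l2norm (w l) ^+ 2)%:C%C.
  rewrite {1}/y dot_suml rmorph_sum; apply: eq_bigr => l _.
  rewrite dotZl dot_sumr (bigD1 l)//= big1 ?addr0; last first.
    by move=> m ml; rewrite dotZr wort ?mulr0// eq_sym.
  by rewrite dotZr mulrA mul_conj_normc dot_self -rmorphM.
have yyx : \sum_l normc (c l) ^+ 2 * l2norm (w l) ^+ 2 <= \sum_l normc (c l) ^+ 2.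
  apply: ler_sum => l _; rewrite ler_piMr ?sqr_ge0// expr_le1 ?l2norm_ge0//.
have := sqr_ge0 (l2norm (x - y)); rewrite -lecR -dot_self dotBl !dotBr.
rewrite (dotC x y) xy conj_realC yy dot_self -!rmorphB lecR.
move: yyx; rewrite -/c => yyx h; lra.
Qed.

Section Basis.
Variables (N : nat) (v : 'I_N -> nat -> C).
Hypothesis vv : forall i j : 'I_N, \sum_l v l i * (v l j)^* = (i == j)%:R.
Hypothesis vort : forall l m, \sum_(i < N) v l i * (v m i)^* = (l == m)%:R.
Let f l := ftrunc N (v l).

Lemma fnorm_basis l : fnorm N (v l) = 1.
Proof.
have : fnorm N (v l) ^+ 2 = 1.
  apply: complexI; rewrite fnorm_sq rmorph_sum /=.
  by under eq_bigr do rewrite -mul_conj_normc; rewrite vort eqxx.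
move/eqP; rewrite sqrf_eq1 => /orP[/eqP//|/eqP h].
by have := fnorm_ge0 N (v l); rewrite h ler0N1.
Qed.

Lemma dot_basis T S l m : dot (T (f l)) (S (f m)) =
  \sum_(i < N) \sum_(j < N)
    v l i * (v m j)^* * dot (T (ebasis R i)) (S (ebasis R j)).
Proof.
rewrite dot_op_ftrunc; apply: eq_bigr => i _.
rewrite linear_sum dot_sumr mulr_sumr; apply: eq_bigr => j _.
by rewrite linearZ dotZr; ring.
Qed.

Lemma trace_basis P :
  \sum_(n < N) P (ebasis R n) n = \sum_l dot (P (f l)) (f l).
Proof.
pose Id : op R := idfun.
under [RHS]eq_bigr do rewrite -[X in dot _ X]/(Id (f _)) dot_basis.
rewrite -(trace_invariance (fun i j => dot (P (ebasis R i)) (Id (ebasis R j))) vv).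
by apply: eq_bigr => n _; rewrite dot_ebasis.
Qed.

End Basis.

(** Diagonalizing the Gram matrix of T e_0, .., T e_(N-1) gives an orthonormal
    basis f_l of the span of e_0, .., e_(N-1) with T f_l pairwise orthogonal.
    Then the trace of |T| over the first N coordinates is at most the sum of the
    |T f_l|, and that sum is the pairing of T with the contraction which
    sends the unit vector along T f_l to f_l. *)
Lemma trace_abs_le T (c : R) : continuous T ->
  (forall I N X, section_bound 1 I N X ->
    normc (\sum_(i < I) \sum_(n < N) X i n * mxentry T i n) <= c) ->
  (trace_abs_pow 1 T <= c%:E)%E.
Proof.
move=> cT Tc; apply: trace_abs1_le => // N.
have absT := op_absP cT.
have [v [vv vort vG]] := @spectral_basis N
  (fun i j => dot (T (ebasis R i)) (T (ebasis R j))) (fun i j => dotC _ _).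
pose f l := ftrunc N (v l); pose sg l := l2norm (T (f l)).
pose w l := ((sg l)^-1)%:C%C *: T (f l).
have f1 l : l2norm (f l) = 1 by rewrite l2norm_ftrunc (fnorm_basis vort).
have Tort l m : l != m -> dot (T (f l)) (T (f m)) = 0.
  by move=> lm; rewrite dot_basis vG.
have wort l m : l != m -> dot (w l) (w m) = 0.
  by move=> lm; rewrite dotZl dotZr Tort// !mulr0.
have sg0 l : 0 <= sg l by exact: l2norm_ge0.
have w1 l : l2norm (w l) <= 1.
  rewrite l2normZ normc_real ?invr_ge0// -/(sg l).
  by have [->|s0] := eqVneq (sg l) 0; rewrite ?mulr0 ?mulVf.
have Tw l : dot (T (f l)) (w l) = (sg l)%:C%C.
  rewrite dotZr dot_self conj_realC -rmorphM -/(sg l).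
  by have [->|s0] := eqVneq (sg l) 0; rewrite ?expr0n ?mulr0// expr2 mulKf.
pose X i n := \sum_l v l n * (w l i)^*.
have XI I : section_bound 1 I N X.
  move=> a b; rewrite mul1r.
  have -> : bilform X I N a b = \sum_l (\sum_(n < N) v l n * b n) * dot (ftrunc I a) (w l).
    under [RHS]eq_bigr do rewrite dot_ftrunc mulr_suml.
    rewrite exchange_big /= /bilform exchange_big /=; apply: eq_bigr => n _.
    under [RHS]eq_bigr do rewrite mulr_sumr.
    rewrite exchange_big /=; apply: eq_bigr => i _.
    by rewrite mulr_suml mulr_suml; apply: eq_bigr => l _; ring.
  apply: le_trans (normc_sum _) _.
  under eq_bigr do rewrite Normc.normcM.
  apply: le_trans (sum_CS _ _) _.
  rewrite parseval// sqrtr_sqr ger0_norm ?fnorm_ge0// mulrC ler_wpM2r ?fnorm_ge0//.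
  rewrite -[leRHS]ger0_norm ?fnorm_ge0// -sqrtr_sqr ler_wsqrtr// -l2norm_ftrunc.
  exact: bessel.
have sgc : \sum_l sg l <= c.
  have -> : \sum_l sg l = normc (\sum_l dot (T (f l)) (w l)).
    rewrite [X in normc X](eq_bigr (fun l => (sg l)%:C%C)) => [|l _]; last exact: Tw.
    by rewrite -rmorph_sum normc_real// sumr_ge0.
  have lim : (fun I => \sum_l \sum_(i < I) T (f l) i * (w l i)^*) @ \oo -->
      \sum_l dot (T (f l)) (w l).
    by apply: cvg_sum_ord => l; exact: dot_cvg_sum.
  apply: (cvg_normc_le lim); apply: nearW => I.
  rewrite (_ : (\sum_l _) = \sum_(i < I) \sum_(n < N) X i n * mxentry T i n).
    exact: Tc.
  rewrite exchange_big /=; apply: eq_bigr => i _.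
  under eq_bigr do rewrite op_ftrunc mulr_suml.
  rewrite exchange_big /=; apply: eq_bigr => n _.
  by rewrite mulr_suml; apply: eq_bigr => l _; ring.
apply: le_trans sgc; rewrite -raddf_sum (trace_basis vv) raddf_sum /=.
apply: ler_sum => l _; apply: le_trans (Re_le_normc _) _.
by apply: le_trans (dot_CS _ _) _; rewrite (l2norm_abs absT) f1 mulr1.
Qed.

(** When T has finitely many nonzero columns, |T| lives on their span, where
    it has an orthonormal basis f_l of eigenvectors; for these
    |T f_l| = (|T| f_l, f_l), so tr |T| is the sum of the |T f_l| and
    dominates every pairing of T with a contraction. *)
Lemma trace_abs_ge T I N X : continuous T ->
  (forall n, (N <= n)%N -> T (ebasis R n) = 0) -> section_bound 1 I N X ->
  ((normc (\sum_(i < I) \sum_(n < N) X i n * mxentry T i n))%:E <= trace_abs_pow 1 T)%E.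
Proof.
move=> cT T0 X1; apply: le_trans (trace_abs1_ge N cT); rewrite lee_fin.
have absT := op_absP cT; set P := op_abs T in absT *.
have [_ P0 _] := absT; have Psym := positive_symmetric P0.
have [v [vv vort vP]] := @spectral_basis N
  (fun i j => dot (P (ebasis R i)) (ebasis R j))
  (fun i j => etrans (Psym _ _) (dotC _ _)).
pose f l := ftrunc N (v l).
have Pf l : (l2norm (P (f l)))%:C%C = dot (P (f l)) (f l).
  have dP m : m != l -> dot (P (f l)) (f m) = 0.
    move=> ml; rewrite -[f m]/((idfun : op R) (f m)) dot_basis.
    by rewrite -[RHS](vP l m) 1?eq_sym.
  have d0 : 0 <= dot (P (f l)) (f l) by exact: P0.
  have dE : dot (P (f l)) (f l) = (normc (dot (P (f l)) (f l)))%:C%C.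
    by rewrite normc_normE ger0_norm.
  rewrite [RHS]dE; congr (_%:C%C).
  have PfN : l2norm (P (f l)) = fnorm N (P (f l)).
    apply/eqP; rewrite eq_le fnorm_le_l2norm andbT.
    have -> : P (f l) = ftrunc N (P (f l)).
      apply: ell2P => j; rewrite ftruncE; case: ltnP => // Nj.
      rewrite -dot_ebasis Psym.
      have /l2norm_eq0 -> : l2norm (P (ebasis R j)) = 0.
        by rewrite (l2norm_abs absT) T0// l2norm0.
      by rewrite dot0r.
    by rewrite l2norm_ftrunc; apply: le_fnorm => i iN; rewrite ftruncE iN.
  apply/eqP; rewrite -(@eqrXn2 _ 2) ?l2norm_ge0 ?normc_ge0// PfN.
  rewrite -fnorm_conj -(parseval _ vv) (bigD1 l)//= [X in _ + X]big1 ?addr0; last first.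
    move=> m ml; have := dP m ml.
    by rewrite dotC dot_ftrunc => /(congr1 (@normc R)); rewrite normc_conj => ->;
      rewrite Normc.normc0 expr0n.
  by rewrite [dot _ (f l)]dotC dot_ftrunc normc_conj.
have -> : \sum_(n < N) complex.Re (P (ebasis R n) n) = \sum_l l2norm (P (f l)).
  rewrite -raddf_sum (trace_basis vv) raddf_sum /=.
  by apply: eq_bigr => l _; rewrite -Pf.
have -> : \sum_(i < I) \sum_(n < N) X i n * mxentry T i n =
    \sum_l bilform X I N (T (f l)) (fun n => (v l n)^*).
  rewrite exchange_big /=.
  rewrite (trace_invariance (fun i j => \sum_(k < I) X k j * mxentry T k i) vv).
  apply: eq_bigr => l _; rewrite /bilform [LHS]exchange_big [RHS]exchange_big /=.
  apply: eq_bigr => j _.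
  under eq_bigr do rewrite mulr_sumr.
  rewrite exchange_big /=; apply: eq_bigr => k _.
  rewrite op_ftrunc mulr_sumr mulr_suml; apply: eq_bigr => i _; ring.
apply: le_trans (normc_sum _) _; apply: ler_sum => l _.
apply: le_trans (X1 _ _) _; rewrite fnorm_conj (fnorm_basis vort) mulr1 mul1r.
by rewrite (l2norm_abs absT); exact: fnorm_le_l2norm.
Qed.

End TraceDuality.

(** * Linear Schur multipliers on finite sections *)

Section Multipliers.
Variable R : realType.
Implicit Types (f g : nat -> R[i]) (x y z : ell2 R) (T S A B : op R).
Implicit Types (m X : nat -> nat -> R[i]) (M : nat -> nat -> nat -> R[i]).

Lemma normc_le_fnorm N f i : (i < N)%N -> normc (f i) <= fnorm N f.
Proof.
move=> iN; rewrite -ler_sqr ?nnegrE ?normc_ge0 ?fnorm_ge0// [leRHS]fnorm_sq.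
rewrite (bigD1 (Ordinal iN))//= lerDl.
by apply: sumr_ge0 => j _; exact: sqr_ge0.
Qed.

Lemma fnorm_normalize N f : exists u, fnorm N u <= 1 /\
  forall i, (i < N)%N -> f i = (fnorm N f)%:C%C * u i.
Proof.
exists (fun i => ((fnorm N f)^-1)%:C%C * f i); split.
  rewrite fnormZ normc_real ?invr_ge0 ?fnorm_ge0//.
  by have [->|f0] := eqVneq (fnorm N f) 0; rewrite ?mulr0 ?mulVf.
move=> i iN; have [f0|f0] := eqVneq (fnorm N f) 0; last first.
  by rewrite mulrA -rmorphM mulfV// mul1r.
rewrite f0 mul0r; apply: Normc.eq0_normc; apply/eqP.
by rewrite eq_le normc_ge0 andbT -f0 normc_le_fnorm.
Qed.

Lemma bilform_normalize X I N f g (a b : R[i]) u w :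
  (forall i, (i < I)%N -> f i = a * u i) -> (forall n, (n < N)%N -> g n = b * w n) ->
  bilform X I N f g = a * b * bilform X I N u w.
Proof.
move=> fu gw; rewrite /bilform mulr_sumr; apply: eq_bigr => i _.
rewrite mulr_sumr; apply: eq_bigr => n _.
by rewrite fu// gw//; ring.
Qed.

(** By homogeneity, unit vectors suffice. *)
Lemma section_bound_unit X I N (C : R) :
  (forall u w, fnorm I u <= 1 -> fnorm N w <= 1 -> normc (bilform X I N u w) <= C) ->
  section_bound C I N X.
Proof.
move=> XC f g; have [u [u1 fu]] := fnorm_normalize I f.
have [w [w1 gw]] := fnorm_normalize N g.
rewrite (bilform_normalize _ fu gw) !Normc.normcM !normc_real ?fnorm_ge0//.
by rewrite mulrC ler_wpM2r ?mulr_ge0 ?fnorm_ge0// XC.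
Qed.

Lemma section_bound_rank1 I N (u w : nat -> R[i]) : fnorm I u <= 1 -> fnorm N w <= 1 ->
  section_bound 1 I N (fun i n => u i * w n).
Proof.
move=> u1 w1 f g.
have -> : bilform (fun i n => u i * w n) I N f g =
    (\sum_(i < I) u i * f i) * (\sum_(n < N) w n * g n).
  rewrite mulr_suml; apply: eq_bigr => i _.
  by rewrite mulr_sumr; apply: eq_bigr => n _; ring.
rewrite Normc.normcM mul1r; apply: ler_pM; rewrite ?normc_ge0//.
  by apply: le_trans (fnorm_CS _ _ _) _; rewrite ler_piMl ?fnorm_ge0.
by apply: le_trans (fnorm_CS _ _ _) _; rewrite ler_piMl ?fnorm_ge0.
Qed.

Lemma eq_section_bound X Y I N (C : R) :
  (forall i n, (i < I)%N -> (n < N)%N -> X i n = Y i n) ->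
  section_bound C I N X -> section_bound C I N Y.
Proof.
move=> XY XC f g; rewrite (_ : bilform Y I N f g = bilform X I N f g); first exact: XC.
by apply: eq_bigr => i _; apply: eq_bigr => n _; rewrite XY.
Qed.

Lemma l2norm_ebasis k : l2norm (ebasis R k) = 1.
Proof.
have : l2norm (ebasis R k) ^+ 2 = 1.
  by apply: complexI; rewrite -dot_self dot_ebasis ebasisE eqxx.
move/eqP; rewrite sqrf_eq1 => /orP[/eqP//|/eqP h].
by have := l2norm_ge0 (ebasis R k); rewrite h ler0N1.
Qed.

Lemma finite_matrix_op I N X (C : R) : 0 <= C -> section_bound C I N X ->
  exists T, [/\ compact_op T, (opnorm T <= C%:E)%E &
    forall i n, (i < I)%N -> (n < N)%N -> mxentry T i n = X i n].
Proof.
move=> C0 XC.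
have [T TE] : exists T : op R, T =1 (fun x => ftrunc I (fun i => \sum_(n < N) X i n * x n)).
  apply: linear_op => c x y; apply: ell2P => i.
  rewrite ell2DE ell2ZE !ftruncE; case: ifP => _; last by rewrite mulr0 addr0.
  rewrite mulr_sumr -big_split /=; apply: eq_bigr => n _.
  by rewrite -[X in _ * X = _]/(c * x n + y n); ring.
have TC x : l2norm (T x) <= C * l2norm x.
  rewrite TE l2norm_ftrunc; apply: le_trans (section_bound_fnorm _ C0 XC) _.
  by rewrite ler_wpM2l// fnorm_le_l2norm.
exists T; split; last 2 first.
- exact: opnorm_le.
- move=> i n iI nN; rewrite /mxentry TE ftruncE iI.
  rewrite (bigD1 (Ordinal nN))//= /delta eqxx mulr1 big1 ?addr0// => j jn.
  by rewrite -val_eqE /= in jn; rewrite (negPf jn) mulr0.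
apply: tail_compact_op; first exact: bounded_continuous TC.
move=> e e0; exists I => x _; rewrite /tail TE.
rewrite (_ : _ - _ = 0) ?l2norm0 ?ltW//.
by apply: ell2P => i; rewrite ell2BE !ftruncE; case: ifP => _; rewrite subrr.
Qed.

(** The finite form of being a Schur multiplier of norm at most s on operators. *)
Definition schur_section_bound (s : R) m := forall I N X,
  section_bound 1 I N X -> section_bound s I N (fun i n => m i n * X i n).

Lemma linear_schur_norm_ge0 m : (0 <= linear_schur_norm (@compact_op R) (@opnorm R) m)%E.
Proof.
have s0 : section_bound 0 0 0 (fun _ _ => 0 : R[i]).
  by move=> f g; rewrite /bilform big_ord0 Normc.normc0 mul0r.
have [Z [Zc Z0 _]] := finite_matrix_op (lexx 0) s0.
have ZE i n : mxentry Z i n = 0.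
  apply: Normc.eq0_normc; apply/eqP; rewrite eq_le normc_ge0 andbT.
  apply: le_trans (normc_le_l2norm _ _) _; apply: le_trans (opnorm_bound Z0 _) _.
  by rewrite mul0r.
apply: le_trans (opnorm_ge0 Z) _; apply: ereal_sup_ubound; exists Z => //; split=> //.
exists Z; split=> //; first by apply: le_trans Z0 _; rewrite lee_fin.
by move=> i j; rewrite !ZE mulr0.
Qed.

(** A finite section of norm at most 1 is a compact operator of norm at most
    1, so the multiplier property applies to it. *)
Lemma schur_section_of_linear m (s : R) : 0 <= s ->
  linear_schur_multiplier (@compact_op R) (@opnorm R) m ->
  (linear_schur_norm (@compact_op R) (@opnorm R) m <= s%:E)%E ->
  schur_section_bound s m.
Proof.
move=> s0 [c mc] ms I N X X1.
have [A [cA A1 AX]] := finite_matrix_op ler01 X1.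
have [T [cT TA _]] := mc A cA.
have Ts : (opnorm T <= s%:E)%E.
  by apply: le_trans ms; apply: ereal_sup_ubound; exists T => //; split=> //; exists A.
apply: (@eq_section_bound (mxentry T)).
  by move=> i n iI nN; rewrite TA AX.
exact: section_bound_op s0 (opnorm_bound Ts).
Qed.

(** Test on a matrix unit. *)
Lemma schur_section_entry m (s : R) i n : 0 <= s -> schur_section_bound s m ->
  normc (m i n) <= s.
Proof.
move=> s0 ms.
have d1 k N : fnorm N (delta R k) <= 1.
  by apply: le_trans (fnorm_le_l2norm N (ebasis R k)) _; rewrite l2norm_ebasis.
have := section_bound_fnorm (delta R n) s0
  (ms _ _ _ (section_bound_rank1 (d1 i i.+1) (d1 n n.+1))).
move=> h; apply: le_trans (le_trans h _); last by rewrite ler_piMr.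
have := @normc_le_fnorm i.+1 (fun k => \sum_(j < n.+1)
  m k j * (delta R i k * delta R n j) * delta R n j) i (ltnSn i).
apply: le_trans; rewrite le_eqVlt; apply/orP; left; apply/eqP; congr normc.
rewrite big_ord_recr /= big1 ?add0r; first by rewrite /delta !eqxx !mulr1.
by move=> j _; rewrite /delta (ltn_eqF (ltn_ord j)) !mulr0.
Qed.

(** Homogeneity in the bound; C = 0 is reached as a limit. *)
Lemma schur_sectionZ m (s C : R) I N X : 0 <= s -> 0 <= C -> schur_section_bound s m ->
  section_bound C I N X -> section_bound (s * C) I N (fun i n => m i n * X i n).
Proof.
move=> s0 C0 ms XC f g; set b := bilform _ _ _ _ _.
rewrite -subr_le0.
apply: (@le0_of_vanishing _ harmonic (s * (fnorm I f * fnorm N g))) => [|n].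
  exact: cvg_harmonic.
set e := harmonic n; have e0 : 0 < e by exact: harmonic_gt0.
have Ce : 0 < C + e by rewrite ltr_wpDl.
have : section_bound 1 I N (fun i n => ((C + e)^-1)%:C%C * X i n).
  move=> f' g'; rewrite mul1r.
  have -> : bilform (fun i n => ((C + e)^-1)%:C%C * X i n) I N f' g' =
      ((C + e)^-1)%:C%C * bilform X I N f' g'.
    rewrite /bilform mulr_sumr; apply: eq_bigr => i _.
    by rewrite mulr_sumr; apply: eq_bigr => j _; rewrite !mulrA.
  rewrite Normc.normcM normc_real ?invr_ge0 ?(ltW Ce)// ler_pdivrMl//.
  apply: le_trans (XC _ _) _.
  by rewrite ler_wpM2r ?mulr_ge0 ?fnorm_ge0// lerDl ltW.
move=> /ms/(_ f g).
have -> : bilform (fun i n => m i n * (((C + e)^-1)%:C%C * X i n)) I N f g =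
    ((C + e)^-1)%:C%C * b.
  rewrite /b /bilform mulr_sumr; apply: eq_bigr => i _.
  by rewrite mulr_sumr; apply: eq_bigr => j _; ring.
rewrite Normc.normcM normc_real ?invr_ge0 ?(ltW Ce)// ler_pdivrMl// => h.
by rewrite lerBlDl; apply: le_trans h _; rewrite le_eqVlt; apply/orP; left; apply/eqP; ring.
Qed.

Lemma row_tail_op T N : exists T', (T' =1 fun x => T x - ftrunc N (T x)) /\
  forall i n, mxentry T' i n = if (i < N)%N then 0 else mxentry T i n.
Proof.
have [T' TE] : exists T' : op R, T' =1 (fun x => T x - ftrunc N (T x)).
  apply: linear_op => c x y; rewrite linearP; apply: ell2P => i.
  rewrite !(ell2DE, ell2NE, ell2ZE) !ftruncE; case: ifP => _; last by rewrite !subr0.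
  by rewrite ell2DE ell2ZE; ring.
exists T'; split=> // i n; rewrite /mxentry TE ell2BE ftruncE.
by case: ifP => _; rewrite ?subrr ?subr0.
Qed.

(** The product is compact because cutting off the first rows commutes with
    Schur multiplication: A with its first N rows removed has small norm, hence
    so has the product with its first N rows removed. *)
Lemma linear_of_schur_section m (s : R) : 0 <= s -> schur_section_bound s m ->
  linear_schur_multiplier (@compact_op R) (@opnorm R) m.
Proof.
move=> s0 ms; exists s => A cA.
have fA := opnorm_fin_num cA.1; set a := fine (opnorm A).
have aE : opnorm A = a%:E by rewrite fineK.
have a0 : 0 <= a by rewrite fine_ge0// opnorm_ge0.
have Aa : forall x, l2norm (A x) <= a * l2norm x by apply: opnorm_bound; rewrite aE.
have mA I N : section_bound (s * a) I N (fun i n => m i n * mxentry A i n).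
  by apply: schur_sectionZ => //; exact: section_bound_op.
have [T [Tb TE]] := matrix_op (mulr_ge0 s0 a0) mA.
have cT : continuous T by exact: bounded_continuous Tb.
exists T; split; last by rewrite aE -EFinM; apply: opnorm_le => //; exact: mulr_ge0.
  apply: tail_compact_op => // e e0.
  (* s + 1 and not s, since s may be 0. *)
  have s1 : 0 < s + 1 by rewrite ltr_wpDl.
  have d0 : 0 < e / (s + 1) by rewrite divr_gt0.
  have [N HN] := compact_op_tail cA d0; exists N => x x1.
  have [A' [A'E A'm]] := row_tail_op A N; have [T' [T'E T'm]] := row_tail_op T N.
  have A'b : forall z, l2norm (A' z) <= e / (s + 1) * l2norm z.
    apply: opnorm_bound; apply: ge_ereal_sup => _ [z /unit_ballP z1 <-].
    by rewrite lee_fin A'E; exact: HN.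
  have cT' : continuous T'.
    apply: (@bounded_continuous _ _ (s * a)) => z.
    by rewrite T'E; apply: le_trans (tail_le _ _) _; exact: Tb.
  have T'b : forall z, l2norm (T' z) <= s * (e / (s + 1)) * l2norm z.
    have d0' := ltW d0.
    apply: op_bound_section => // [|I K]; first exact: mulr_ge0.
    apply: (@eq_section_bound (fun i n => m i n * mxentry A' i n)).
      by move=> i n _ _; rewrite T'm A'm TE; case: ifP => _; rewrite ?mulr0.
    by apply: schur_sectionZ => //; exact: section_bound_op.
  rewrite /tail -T'E; apply: le_trans (T'b x) _.
  apply: (@le_trans _ _ (s * (e / (s + 1)))).
    by rewrite ler_piMr// mulr_ge0// ltW.
  by rewrite mulrCA ler_piMr ?ltW// ltr_pdivrMr// mul1r ltrDl.
by move=> i j; rewrite TE.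
Qed.

Lemma linear_norm_of_schur_section m (s : R) : 0 <= s -> schur_section_bound s m ->
  (linear_schur_norm (@compact_op R) (@opnorm R) m <= s%:E)%E.
Proof.
move=> s0 ms; apply: ge_ereal_sup => _ [T [cT [A [cA A1 TA]]] <-].
apply: opnorm_le => //; apply: op_bound_section => // [|I N]; first by case: cT.
apply: (@eq_section_bound (fun i n => m i n * mxentry A i n)).
  by move=> i n _ _; rewrite TA.
rewrite -[s]mulr1; apply: schur_sectionZ => //.
exact: section_bound_op (opnorm_bound A1).
Qed.

End Multipliers.

(** * Bilinear Schur multipliers *)

Section BilinearMultipliers.
Variable R : realType.
Implicit Types (f g : nat -> R[i]) (x y z : ell2 R) (T S A B : op R).
Implicit Types (m X : nat -> nat -> R[i]) (M : nat -> nat -> nat -> R[i]).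

(** The Schatten norm depends on an operator only through its graph, since
    |T| is chosen from a set that depends only on the graph of T. *)
Lemma schatten_norm_ext p T S : continuous T -> continuous S ->
  mxentry T = mxentry S -> schatten_norm p T = schatten_norm p S.
Proof.
move=> cT cS TS.
have [a a0 Ta] := continuous_bounded cT; have [b b0 Sb] := continuous_bounded cS.
have E : (T : ell2 R -> ell2 R) = S.
  apply/funext => x; apply/eqP; rewrite -subr_eq0; apply/eqP; apply: l2norm_eq0.
  apply/eqP; rewrite eq_le l2norm_ge0 andbT; apply/ler_addgt0Pr => e e0.
  have e2 : 0 < e / 2 by rewrite divr_gt0.
  have [N1 HN1] := ftrunc_dist a0 Ta x e2; have [N2 HN2] := ftrunc_dist b0 Sb x e2.
  pose N := maxn N1 N2.
  have TSN : T (ftrunc N x) = S (ftrunc N x).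
    by apply: ell2P => i; rewrite !op_ftrunc TS.
  rewrite add0r -(subrK (T (ftrunc N x)) (T x)) {2}TSN -addrA.
  apply: le_trans (l2normD _ _) _; rewrite [e]splitr; apply: lerD; apply: ltW.
    by apply: HN1; exact: leq_maxl.
  by rewrite l2normB; apply: HN2; exact: leq_maxr.
have absE : is_abs T = is_abs S.
  by rewrite predeqE => P; rewrite /is_abs /is_adjoint /= E.
by rewrite /schatten_norm /trace_abs_pow /op_abs absE.
Qed.

Section Sufficiency.
Variables (M : nat -> nat -> nat -> R[i]) (s : R).
Hypothesis s0 : 0 <= s.
Hypothesis Ms : forall k, schur_section_bound s (fun i j => M i k j).
Variables (A B : op R) (a b : R).
Hypothesis a0 : 0 <= a.
Hypothesis b0 : 0 <= b.
Hypothesis Aa : forall N, \sum_(n < N) l2norm (A (ebasis R n)) ^+ 2 <= a ^+ 2.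
Hypothesis Bb : forall N, \sum_(n < N) l2norm (B (ebasis R n)) ^+ 2 <= b ^+ 2.

(** Each k contributes a finite section of M(k) tested on the k-th column of A
    and the k-th row of B; Cauchy-Schwarz in k then produces the two
    Hilbert-Schmidt norms. *)
Lemma partial_pairing_bound I N K X : section_bound 1 I N X ->
  normc (\sum_(i < I) \sum_(n < N) X i n *
    \sum_(k < K) M i k n * mxentry A i k * mxentry B k n) <= s * (a * b).
Proof.
move=> X1.
have -> : \sum_(i < I) \sum_(n < N) X i n *
    \sum_(k < K) M i k n * mxentry A i k * mxentry B k n =
    \sum_(k < K) bilform (fun i n => M i k n * X i n) I N
      (fun i => mxentry A i k) (mxentry B k).
  rewrite [RHS]exchange_big; apply: eq_bigr => i _.
  rewrite [RHS]exchange_big; apply: eq_bigr => n _.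
  by rewrite mulr_sumr; apply: eq_bigr => k _; rewrite /=; ring.
apply: le_trans (normc_sum _) _.
apply: le_trans (ler_sum _ (fun k _ => Ms (val k) X1 _ _)) _.
rewrite -mulr_sumr ler_wpM2l//; apply: le_trans (sum_CS _ _) _.
apply: ler_pM; rewrite ?sqrtr_ge0//.
  rewrite -[leRHS]ger0_norm// -sqrtr_sqr ler_wsqrtr//.
  apply: le_trans (Aa K); apply: ler_sum => k _.
  by rewrite ler_sqr ?nnegrE ?fnorm_ge0 ?l2norm_ge0//; exact: fnorm_le_l2norm.
rewrite -[leRHS]ger0_norm// -sqrtr_sqr ler_wsqrtr//.
apply: le_trans (Bb N); under eq_bigr do rewrite fnorm_sq.
rewrite exchange_big /=; apply: ler_sum => n _.
apply: le_trans (_ : fnorm K (B (ebasis R n)) ^+ 2 <= _); first by rewrite fnorm_sq.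
by rewrite ler_sqr ?nnegrE ?fnorm_ge0 ?l2norm_ge0//; exact: fnorm_le_l2norm.
Qed.

Lemma product_cvg i n : cvgn (series (fun k => M i k n * mxentry A i k * mxentry B k n)).
Proof.
apply: (@abs_summable_cvg _ _ (s * (a * b))) => K.
apply: (@le_trans _ _ (s * \sum_(k < K) normc (mxentry A i k) * normc (mxentry B k n))).
  rewrite mulr_sumr; apply: ler_sum => k _; rewrite !Normc.normcM -mulrA.
  by rewrite ler_wpM2r ?mulr_ge0 ?normc_ge0// (schur_section_entry i n s0 (Ms k)).
rewrite ler_wpM2l//; apply: le_trans (fnorm_CS_abs _ _ _) _.
apply: ler_pM; rewrite ?fnorm_ge0//.
  rewrite -ler_sqr ?nnegrE ?fnorm_ge0// fnorm_sq.
  apply: le_trans (Aa K); apply: ler_sum => k _.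
  by rewrite ler_sqr ?nnegrE ?normc_ge0 ?l2norm_ge0//; exact: normc_le_l2norm.
apply: le_trans (fnorm_le_l2norm K (B (ebasis R n))) _.
rewrite -ler_sqr ?nnegrE ?l2norm_ge0//; apply: le_trans (Bb n.+1).
by rewrite big_ord_recr /= lerDr; apply: sumr_ge0 => j _; exact: sqr_ge0.
Qed.

Lemma pairing_bound (t : nat -> nat -> R[i]) I N X :
  (forall i n, series (fun k => M i k n * mxentry A i k * mxentry B k n) @ \oo --> t i n) ->
  section_bound 1 I N X ->
  normc (\sum_(i < I) \sum_(n < N) X i n * t i n) <= s * (a * b).
Proof.
move=> tl X1.
have lim : (fun K => \sum_(i < I) \sum_(n < N) X i n *
    \sum_(k < K) M i k n * mxentry A i k * mxentry B k n) @ \oo -->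
    \sum_(i < I) \sum_(n < N) X i n * t i n.
  apply: cvg_sum_ord => i; apply: cvg_sum_ord => n.
  apply: cvgM; first exact: cvg_cst.
  by have := tl i n; rewrite seriesEord.
by apply: (cvg_normc_le lim); apply: nearW => K; exact: partial_pairing_bound.
Qed.

Lemma schatten1_product_le T : continuous T -> schur_product2 M A B T ->
  (schatten_norm 1 T <= (s * (a * b))%:E)%E.
Proof.
move=> cT MT; rewrite schatten_norm1E//; apply: trace_abs_le => // I N X X1.
exact: pairing_bound.
Qed.

Lemma product_exists : exists T, [/\ schatten 1 T, schur_product2 M A B T &
  (schatten_norm 1 T <= (s * (a * b))%:E)%E].
Proof.
pose t i n := limn (series (fun k => M i k n * mxentry A i k * mxentry B k n)).
have tl i n : series (fun k => M i k n * mxentry A i k * mxentry B k n) @ \oo --> t i n.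
  exact: product_cvg.
have C0 : 0 <= s * (a * b) by rewrite !mulr_ge0.
have tC I N : section_bound (s * (a * b)) I N t.
  apply: section_bound_unit => u w u1 w1.
  rewrite (_ : bilform _ _ _ _ _ = \sum_(i < I) \sum_(n < N) (u i * w n) * t i n).
    by apply: (@pairing_bound t I N (fun i n => u i * w n)) => //;
      exact: section_bound_rank1.
  by apply: eq_bigr => i _; apply: eq_bigr => n _; ring.
have [T [TC TE]] := matrix_op C0 tC.
have cT : continuous T by exact: bounded_continuous TC.
have MT : schur_product2 M A B T by move=> i n; rewrite TE.
have Ts := schatten1_product_le cT MT.
by exists T; split=> //; split=> //; exact: le_lt_trans Ts (ltry _).
Qed.

End Sufficiency.

(** Testing M on a column A = u e_k and a row B = e_k w isolates the matrix M(k):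
    the product has entries M(k)_ij u_i w_j, and pairing it with a contraction
    X gives the bilinear form of the section of M(k) X. *)
Lemma schur_section_of_bilinear M (s : R) :
  (forall A B, schatten 2 A -> schatten 2 B ->
    (schatten_norm 2 A <= 1)%E -> (schatten_norm 2 B <= 1)%E ->
    exists T, [/\ schatten 1 T, schur_product2 M A B T &
      (schatten_norm 1 T <= s%:E)%E]) ->
  forall k, schur_section_bound s (fun i j => M i k j).
Proof.
move=> Ms k I N X X1; apply: section_bound_unit => u w u1 w1.
have [A AE] : exists A : op R, A =1 (fun x => x k *: ftrunc I u).
  apply: linear_op => c x y; rewrite ell2DE ell2ZE; ell2_ring.
pose wb := ftrunc N (fun n => (w n)^*).
have [B BE] : exists B : op R, B =1 (fun x => dot x wb *: ebasis R k).
  by apply: linear_op => c x y; rewrite dotDl dotZl; ell2_ring.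
have An n : A (ebasis R n) = (k == n)%:R *: ftrunc I u by rewrite AE ebasisE.
have Bn n : B (ebasis R n) = (wb n)^* *: ebasis R k by rewrite BE dotC dot_ebasis.
have cA : continuous A.
  apply: (@bounded_continuous _ _ 1) => x; rewrite AE l2normZ mul1r l2norm_ftrunc.
  apply: le_trans (_ : normc (x k) <= _); last exact: normc_le_l2norm.
  by rewrite ler_piMr ?normc_ge0.
have wb1 : l2norm wb <= 1 by rewrite l2norm_ftrunc fnorm_conj.
have cB : continuous B.
  apply: (@bounded_continuous _ _ 1) => x; rewrite BE l2normZ l2norm_ebasis mulr1 mul1r.
  by apply: le_trans (dot_CS _ _) _; rewrite ler_piMr ?l2norm_ge0.
have [A2 An2] : schatten 2 A /\ (schatten_norm 2 A <= 1%:E)%E.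
  apply: schatten2_le => // K; rewrite expr1n.
  apply: (@le_trans _ _ (\sum_(n < K) normc (delta R k n) ^+ 2)).
    apply: ler_sum => n _; rewrite ler_sqr ?nnegrE ?normc_ge0 ?l2norm_ge0//.
    by rewrite An l2normZ l2norm_ftrunc /delta eq_sym ler_piMr ?normc_ge0.
  rewrite -fnorm_sq expr_le1 ?fnorm_ge0//.
  by apply: le_trans (fnorm_le_l2norm K (ebasis R k)) _; rewrite l2norm_ebasis.
have [B2 Bn2] : schatten 2 B /\ (schatten_norm 2 B <= 1%:E)%E.
  apply: schatten2_le => // K; rewrite expr1n.
  apply: (@le_trans _ _ (\sum_(n < K) normc (wb n) ^+ 2)).
    apply: ler_sum => n _.
    by rewrite Bn l2normZ normc_conj l2norm_ebasis mulr1.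
  rewrite -fnorm_sq expr_le1 ?fnorm_ge0//.
  exact: le_trans (fnorm_le_l2norm K wb) wb1.
have [T [[cT _] MT Ts]] := Ms A B A2 B2 An2 Bn2.
have TE i n : mxentry T i n = M i k n * ftrunc I u i * (wb n)^*.
  apply: (cvg_uniq (MT i n)); rewrite seriesEord.
  apply: cvg_near_cst; exists k.+1 => // K /= kK.
  rewrite (bigD1 (Ordinal kK))//= big1 ?addr0.
    by rewrite /mxentry An Bn !ell2ZE ebasisE eqxx mul1r mulr1.
  move=> j jk; rewrite -val_eqE /= in jk.
  by rewrite /mxentry An ell2ZE eq_sym (negPf jk) mul0r mulr0 mul0r.
have Tcol n : (N <= n)%N -> T (ebasis R n) = 0.
  move=> Nn; apply: ell2P => i; rewrite -[LHS]/(mxentry T i n) TE.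
  by rewrite [wb n]ftruncE ltnNge Nn /= rmorph0 mulr0.
have := trace_abs_ge cT Tcol X1; rewrite -schatten_norm1E// => h.
have := le_trans h Ts; rewrite lee_fin.
rewrite (_ : bilform _ _ _ _ _ = \sum_(i < I) \sum_(n < N) X i n * mxentry T i n)//.
apply: eq_bigr => i _; apply: eq_bigr => n _.
by rewrite TE !ftruncE !ltn_ord conjCK; ring.
Qed.

End BilinearMultipliers.

(** * The equality of norms *)

Lemma bilinear_schur_norm_ge0 (R : realType) (M : nat -> nat -> nat -> R[i]) :
  bilinear_schur_multiplier 1 M -> (0 <= bilinear_schur_norm 1 M)%E.
Proof.
move=> [c Mc].
have [Z ZE] : exists Z : op R, Z =1 (fun=> 0).
  by apply: linear_op => a x y; rewrite scaler0 addr0.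
have cZ : continuous Z.
  by apply: (@bounded_continuous _ _ 0) => x; rewrite ZE l2norm0 mul0r.
have [Z2 Zn] : schatten 2 Z /\ (schatten_norm 2 Z <= 0%:E)%E.
  apply: schatten2_le => // N; rewrite big1 ?expr0n// => n _.
  by rewrite ZE l2norm0 expr0n.
have Z1 : (schatten_norm 2 Z <= 1)%E by apply: le_trans Zn _; rewrite lee_fin.
have [T [T1 MT _]] := Mc Z Z Z2 Z2.
apply: le_trans (poweR_ge0 _ _) _; apply: ereal_sup_ubound; exists T; first split=> //.
  by exists Z, Z.
by [].
Qed.

Lemma bilinear_schur_norm_lty (R : realType) (M : nat -> nat -> nat -> R[i]) :
  bilinear_schur_multiplier 1 M -> (bilinear_schur_norm 1 M < +oo)%E.
Proof.
move=> [c Mc]; apply: (@le_lt_trans _ _ (Num.max c 0)%:E); last exact: ltry.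
apply: ge_ereal_sup => _ [T [T1 [A [B [A2 B2 A1 B1 MT]]]] <-].
have [T' [T'1 MT' T'c]] := Mc A B A2 B2.
rewrite (@schatten_norm_ext _ 1 T T' T1.1 T'1.1); last first.
  by apply/funext => i; apply/funext => j; exact: cvg_uniq (MT i j) (MT' i j).
apply: le_trans T'c _.
have [a [a0 aE _]] := schatten2_hs A2; have [b [b0 bE _]] := schatten2_hs B2.
rewrite aE lee_fin in A1; rewrite bE lee_fin in B1.
rewrite aE bE -!EFinM lee_fin.
apply: (@le_trans _ _ (Num.max c 0 * a * b)).
  by rewrite !ler_wpM2r// le_max lexx.
by rewrite -mulrA ler_piMr ?le_max ?lexx ?orbT// mulr_ile1.
Qed.

Theorem theorem7 (R : realType) (M : nat -> nat -> nat -> R[i]) :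
  let Mk (k i j : nat) := M i k j in
  let supM :=
    ereal_sup [set linear_schur_norm (@compact_op R) (@opnorm R) (Mk k) |
               k in [set: nat]] in
  (bilinear_schur_multiplier 1 M <->
   (forall k, linear_schur_multiplier (@compact_op R) (@opnorm R) (Mk k)) /\
   (supM < +oo)%E) /\
  (bilinear_schur_multiplier 1 M -> bilinear_schur_norm 1 M = supM).
Proof.
move=> Mk supM.
have supM0 : (0 <= supM)%E.
  apply: le_trans (linear_schur_norm_ge0 (Mk 0%N)) _.
  by apply: ereal_sup_ubound; exists 0%N.
have necessity : bilinear_schur_multiplier 1 M ->
    (forall k, linear_schur_multiplier (@compact_op R) (@opnorm R) (Mk k)) /\
    (supM <= bilinear_schur_norm 1 M)%E.
  move=> HM; have n0 := bilinear_schur_norm_ge0 HM.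
  have nfin : bilinear_schur_norm 1 M \is a fin_num.
    by rewrite ge0_fin_numE// bilinear_schur_norm_lty.
  have s0 : 0 <= fine (bilinear_schur_norm 1 M) by rewrite fine_ge0.
  have ms k : schur_section_bound (fine (bilinear_schur_norm 1 M)) (Mk k).
    apply: schur_section_of_bilinear => A B A2 B2 A1 B1.
    have [c Mc] := HM; have [T [T1 MT _]] := Mc A B A2 B2.
    exists T; split=> //; rewrite fineK//; apply: ereal_sup_ubound.
    by exists T => //; split=> //; exists A, B.
  split=> [k|]; first exact: linear_of_schur_section s0 (ms k).
  apply: ge_ereal_sup => _ [k _ <-].
  by rewrite -(fineK nfin); exact: linear_norm_of_schur_section.
have sections : (forall k, linear_schur_multiplier (@compact_op R) (@opnorm R) (Mk k)) ->
    (supM < +oo)%E -> exists s : R, [/\ 0 <= s, supM = s%:E &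
      forall k, schur_section_bound s (Mk k)].
  move=> Ml supMy; have supMf : supM \is a fin_num by rewrite ge0_fin_numE.
  exists (fine supM); rewrite fine_ge0// fineK//; split=> // k.
  apply: schur_section_of_linear; rewrite ?fine_ge0// fineK//.
  by apply: ereal_sup_ubound; exists k.
split; first split.
- move=> HM; have [Ml supMn] := necessity HM; split=> //.
  exact: le_lt_trans supMn (bilinear_schur_norm_lty HM).
- move=> [Ml /(sections Ml)[s [s0 _ ms]]]; exists s => A B A2 B2.
  have [a [a0 aE Aa]] := schatten2_hs A2; have [b [b0 bE Bb]] := schatten2_hs B2.
  rewrite aE bE -!EFinM -mulrA.
  exact: (@product_exists R M s s0 ms A B a b a0 b0 Aa Bb).
- move=> HM; have [Ml supMn] := necessity HM.
  apply/eqP; rewrite eq_le supMn andbT.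
  have /(sections Ml)[s [s0 -> ms]] := le_lt_trans supMn (bilinear_schur_norm_lty HM).
  apply: ge_ereal_sup => _ [T [T1 [A [B [A2 B2 A1 B1 MT]]]] <-].
  have [a [a0 aE Aa]] := schatten2_hs A2; have [b [b0 bE Bb]] := schatten2_hs B2.
  rewrite aE lee_fin in A1; rewrite bE lee_fin in B1.
  apply: le_trans (schatten1_product_le s0 ms a0 b0 Aa Bb T1.1 MT) _.
  by rewrite lee_fin ler_piMr// mulr_ile1.
Qed.
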